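(* Let $X$ be an infinite connected simple graph (undirected, countable, all vertex degrees finite), and let $\deg X\in\mathbb{Z}^+\cup\{\infty\}$ be the supremum of its vertex degrees. Then $D_L(X)\le\deg X$. If moreover $X$ is repetitive, then $D_{RL}(X)\le\deg X$.
   Context: A simple graph has no loops and at most one edge between any two vertices. A connected graph $X$ (identified with its vertex set) carries the metric $d$ given by minimal path length; $D_X(x,R)=\{y\in X: d(x,y)\le R\}$, regarded as the induced subgraph. A (vertex) coloring of $X$ by $n$ colors is a map $\phi:X\to\{0,\dots,n-1\}$. An isomorphism of pointed colored graphs $(X,x,\phi)\to(Y,y,\psi)$ is a graph isomorphism $f$ with $f(x)=y$ and $\psi\circ f=\phi$; it is defined similarly for colored induced subgraphs. Let $\widehat{\mathcal G}_*$ be the set of isomorphism classes $[Y,y,\psi]$ of pointed connected colored simple graphs with finite vertex degrees, with the topology for which a base of entourages of a (metrizable) uniformity is given by the sets $\widehat U_R$ ($R\in\mathbb{Z}^+$) of pairs $([X,x,\phi],[Y,y,\psi])$ such that $(D_X(x,R),x,\phi)\cong(D_Y(y,R),y,\psi)$. Let $[X,\phi]=\{[X,x,\phi]: x\in X\}$, with closure $\overline{[X,\phi]}$. So $[Y,y,\psi]\in\overline{[X,\phi]}$ iff for every $R\in\mathbb{Z}^+$ there is $x\in X$ with $(D_X(x,R),x,\phi)\cong(D_Y(y,R),y,\psi)$. $(X,\phi)$ is aperiodic if its only color-preserving graph automorphism is the identity. It is limit aperiodic if $(Y,\psi)$ is aperiodic for all $[Y,y,\psi]\in\overline{[X,\phi]}$.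 It is repetitive if there are $p\in X$ and a sequence $R_i\uparrow\infty$ in $\mathbb{Z}^+$ such that, for every $i$, the set $\{x\in X: (D_X(x,R_i),x,\phi)\cong(D_X(p,R_i),p,\phi)\}$ is relatively dense in $X$ (i.e. there is $C>0$ such that every vertex is at distance at most $C$ from this set). An uncolored graph $X$ is repetitive if the same holds with the colorings omitted (equivalently, with a constant coloring). $D_L(X)$ is the infimum of the $n\in\mathbb{Z}^+$ such that $X$ has a limit aperiodic coloring by $n$ colors. For $X$ repetitive, $D_{RL}(X)$ is the infimum of the $n\in\mathbb{Z}^+$ such that $X$ has a repetitive and limit aperiodic coloring by $n$ colors. The infimum of the empty set is $\infty$. *)

(* Defs.v *)
From mathcomp Require Import all_boot all_order all_algebra finmap.
From mathcomp Require Import all_classical all_reals all_analysis.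

Set Implicit Arguments.
Unset Strict Implicit.
Unset Printing Implicit Defensive.

Import Order.TTheory GRing.Theory Num.Theory.

Local Open Scope classical_set_scope.

(* Connected simple graphs with finite vertex degrees. Boolean adjacency and
   the choice structure on the vertices cost no generality, since both exist
   classically on any type. *)
Record graph := Graph {
  vertex :> choiceType;
  adj : rel vertex;
  adj_sym : symmetric adj;
  adj_irr : irreflexive adj;
  adj_conn : forall x y : vertex, exists p : seq vertex,
    path adj x p /\ last x p = y;
  adj_fin : forall x : vertex, finite_set [set y | adj x y] }.

Definition path_length (X : graph) (x y : X) : pred nat := fun n =>
  `[< exists p : seq X, [/\ path (@adj X) x p, last x p = y & size p = n] >].

Lemma path_length_ex (X : graph) (x y : X) : exists n, path_length x y n.
Proof.
have [p [px py]] := adj_conn x y.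
by exists (size p); apply/asboolP; exists p.
Qed.

Definition dist (X : graph) (x y : X) : nat := ex_minn (path_length_ex x y).

Definition disc (X : graph) (x : X) (r : nat) : set X :=
  [set y | (dist x y <= r)%N].

Definition degree (X : graph) (x : X) : nat :=
  #|` fset_set [set y | adj x y] |%fset.

(* Only the restriction of f to the disc matters. *)
Definition disc_iso (X Y : graph) (x : X) (y : Y) (r : nat) (f : X -> Y) :=
  [/\ set_bij (disc x r) (disc y r) f,
      {in disc x r &, forall u v, adj (f u) (f v) = adj u v} & f x = y].

Definition same_disc (X Y : graph) (x : X) (y : Y) (r : nat) :=
  exists f : X -> Y, disc_iso x y r f.

Definition same_col_disc (X Y : graph) (m n : nat)
    (phi : X -> 'I_m) (psi : Y -> 'I_n) (x : X) (y : Y) (r : nat) :=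
  exists2 f : X -> Y, disc_iso x y r f &
    {in disc x r, forall u, psi (f u) = phi u :> nat}.

Definition color_iso (X Y : graph) (m n : nat)
    (phi : X -> 'I_m) (psi : Y -> 'I_n) (f : X -> Y) :=
  [/\ bijective f,
      forall u v, adj (f u) (f v) = adj u v &
      forall u, psi (f u) = phi u :> nat].

Definition aperiodic (X : graph) (n : nat) (phi : X -> 'I_n) :=
  forall f : X -> X, color_iso phi phi f -> forall x, f x = x.

(* The points of the space of isomorphism classes are handled through
   representatives: a subset of that space is an isomorphism-invariant set of
   pointed colored graphs. It is a plain predicate because [set pcgraph] would
   be a universe inconsistency. *)
Record pcgraph := PCGraph {
  pc_graph :> graph;
  pc_point : pc_graph;
  pc_ncolors : nat;
  pc_color : pc_graph -> 'I_pc_ncolors }.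

Definition pc_iso (P Q : pcgraph) :=
  exists2 f : P -> Q, color_iso (@pc_color P) (@pc_color Q) f &
    f (pc_point P) = pc_point Q.

Definition entourage_hat (r : nat) (P Q : pcgraph) :=
  same_col_disc (@pc_color P) (@pc_color Q) (pc_point P) (pc_point Q) r.

Definition closure_hat (S : pcgraph -> Prop) : pcgraph -> Prop := fun Q =>
  forall r, (0 < r)%N -> exists2 P, S P & entourage_hat r P Q.

Definition classes (X : graph) (n : nat) (phi : X -> 'I_n) : pcgraph -> Prop :=
  fun P => exists x : X, pc_iso P (PCGraph x phi).

Definition limit_aperiodic (X : graph) (n : nat) (phi : X -> 'I_n) :=
  forall Q : pcgraph, closure_hat (classes phi) Q -> aperiodic (@pc_color Q).

Definition relatively_dense (X : graph) (A : set X) :=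
  exists2 C : nat, (0 < C)%N & forall x, exists2 a, A a & (dist x a <= C)%N.

Definition repetitive_for (X : graph) (same : X -> X -> nat -> Prop) :=
  exists (p : X) (r : nat -> nat),
    [/\ forall i, (0 < r i)%N,
        {homo r : i j / (i <= j)%N},
        r @ \oo --> \oo &
        forall i, relatively_dense [set x | same x p (r i)]].

Definition repetitive (X : graph) := repetitive_for (@same_disc X X).

Definition repetitive_coloring (X : graph) (n : nat) (phi : X -> 'I_n) :=
  repetitive_for (same_col_disc phi phi).

(* deg X, D_L(X) and D_RL(X) take values in the positive integers together
   with infinity, here seen inside the extended reals. *)
Section parameters.
Variable R : realType.
Local Open Scope ring_scope.

Definition deg (X : graph) : \bar R :=
  ereal_sup [set ((degree x)%:R)%:E | x in [set: X]].

Definition D_L (X : graph) : \bar R :=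
  ereal_inf [set (n%:R)%:E | n in
    [set n | (0 < n)%N /\ exists phi : X -> 'I_n, limit_aperiodic phi]].

Definition D_RL (X : graph) : \bar R :=
  ereal_inf [set (n%:R)%:E | n in
    [set n | (0 < n)%N /\ exists phi : X -> 'I_n,
       repetitive_coloring phi /\ limit_aperiodic phi]].

End parameters.

(* Main.v *)
Require Import Defs.
From mathcomp Require Import all_boot all_order all_algebra finmap.
From mathcomp Require Import all_classical all_reals all_analysis.
From mathcomp Require Import zify.

(** Suppose that all degrees of [X] are at most [D]. If a coloring is such that for
    every [L > 0] there is [R] for which no two vertices at distance exactly [L]
    have isomorphic colored discs of radius [R], then it is limit aperiodic
    ([strongly_aperiodic_limit]): an automorphism of a limit that moves a vertex
    by [L] would be visible on discs of [X]. Such a coloring by [D] colors is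
    built in two steps.

    Breaking local symmetries. Fix a relatively dense set of roots, and give
    every other vertex a parent among its neighbors that are closer to the roots.
    A vertex which is not a root is adjacent to its parent, so it has at most
    [D - 1] children; a root also has at most [D - 1] children once one of its
    neighbors is put aside. Hence [D - 1] nonzero colors are enough to give
    different colors to siblings, and color [0] remains for a sparse set of marks.
    If a colored isomorphism fixes all the neighbors of [v] that are closer to the
    roots, then [v] and its image have the same parent and the same color, so
    [v] is fixed. By induction on the distance to the roots, everything near [v]
    is fixed as soon as the roots near [v] are ([step_rigid]).

    Fixing roots. The marks come in layers of rapidly increasing radius, and
    layer [n] has its own roots. Around each of them, the numbers of marks in the
    concentric shells encode a label, and roots at a distance comparable to the
    radius get different labels. So an isomorphism with a displacement at some
    vertex below the radius of the layer must fix a root of the layer nearby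
    ([roots_rigid]); the first layer then shows that displacements at most two
    are zero, so all neighbors of a fixed vertex are fixed ([coloring_rigid]).
    Each layer avoids the discs around the roots of the preceding ones, therefore
    the layers can be recognized one after another from the color [0] alone
    ([local_marks_from]).

    The point is to have enough labels with only the vertices of a disc of radius
    [rho] to encode them, whereas the roots in a disc of radius [C * rho] need
    different labels. There are always exponentially many labels in [rho], which
    is enough around [x] if the disc of radius [C * rho] has at most that many
    vertices. If it has more, then some disc of radius [rho] close to [x] has
    exponentially many vertices (it is called rich below), thus several shells
    with exponentially many places for marks, and the number of labels at its
    center exceeds any prescribed exponential in [rho]
    ([capacity_small], [capacity_rich], [layer_cover], [layer_exists]).

    For the second assertion, compare colorings by [psi <= phi] when all colored
    discs of [psi] occur in [phi]; limit aperiodicity passes from [phi] to [psi].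
    By compactness and Zorn's lemma there is a minimal coloring below any [phi]
    ([minimal_coloring]), and on a repetitive graph a minimal coloring is
    repetitive ([minimal_repetitive]), by the usual argument that minimal
    subshifts consist of uniformly recurrent points. *)

Set Implicit Arguments.
Unset Strict Implicit.
Unset Printing Implicit Defensive.

Local Open Scope classical_set_scope.

(** * The path metric *)

Lemma distP (X : graph) (x y : X) (n : nat) :
  reflect (exists p : seq X, [/\ path (@adj X) x p, last x p = y & size p <= n])
          (dist x y <= n).
Proof.
rewrite /dist; case: ex_minnP => m hm mmin; apply: (iffP idP) => [mn|].
  by case/asboolP: hm => p [pp lp sp]; exists p; split=> //; rewrite sp.
case=> q [pq lq sq].
by apply: leq_trans sq; apply: mmin; apply/asboolP; exists q.
Qed.

Lemma dist_refl (X : graph) (x : X) : dist x x = 0.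
Proof. by apply/eqP; rewrite -leqn0; apply/distP; exists [::]. Qed.

Lemma dist_eq0 (X : graph) (x y : X) : dist x y = 0 -> x = y.
Proof. by move=> d0; have /distP[[|a p] []] : dist x y <= 0 by rewrite d0. Qed.

Lemma dist_triangle (X : graph) (y x z : X) : dist x z <= dist x y + dist y z.
Proof.
have /distP[p [pp lp sp]] := leqnn (dist x y).
have /distP[q [pq lq sq]] := leqnn (dist y z).
apply/distP; exists (p ++ q); rewrite cat_path pp lp pq last_cat lp lq size_cat.
by split=> //; apply: leq_add.
Qed.

Lemma dist_adj (X : graph) (x y : X) : adj x y -> dist x y <= 1.
Proof. by move=> xy; apply/distP; exists [:: y]; rewrite /= xy. Qed.

Lemma dist_sym (X : graph) (x y : X) : dist x y = dist y x.
Proof.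
have half (u v : X) : dist u v <= dist v u.
  have /distP[p [pp lp sp]] := leqnn (dist v u).
  apply/distP; exists (rev (belast v p)); split.
  - by rewrite -lp rev_path (eq_path (e' := @adj X)) // => a b; rewrite adj_sym.
  - by case: p lp {pp sp} => [/=->//|a p _] /=; rewrite rev_cons last_rcons.
  - by rewrite size_rev size_belast.
by apply/eqP; rewrite eqn_leq !half.
Qed.

Lemma adj_dist (X : graph) (x y : X) : dist x y = 1 -> adj x y.
Proof.
move=> d1; have /distP[[|a [|b p]] [//=]] : dist x y <= 1 by rewrite d1.
  by move=> _ exy; move: d1; rewrite exy dist_refl.
by rewrite andbT => xa <-.
Qed.

Lemma dist_adjE (X : graph) (x y : X) : adj x y -> dist x y = 1.
Proof.
move=> xy; have := dist_adj xy; case E: (dist x y) => [|[|//]] // _.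
by move: xy; rewrite (dist_eq0 E) adj_irr.
Qed.

Lemma dist_pred (X : graph) (x y : X) n : dist x y = n.+1 ->
  exists2 z, adj x z & dist z y = n.
Proof.
move=> d; have /distP[[|z p] [/=]] : dist x y <= n.+1 by rewrite d.
  by move=> _ exy; move: d; rewrite exy dist_refl.
case/andP=> xz pz lz sz; exists z => //; apply/eqP; rewrite eqn_leq.
have -> /= : dist z y <= n by apply/distP; exists p.
by have := dist_triangle z x y; have := dist_adj xz; lia.
Qed.

Lemma dist_predr (X : graph) (x y : X) n : dist x y = n.+1 ->
  exists2 z, adj z y & dist x z = n.
Proof.
rewrite dist_sym => /dist_pred[z yz zx]; exists z; first by rewrite adj_sym.
by rewrite dist_sym.
Qed.

Lemma dist_between (X : graph) (x y : X) k : k <= dist x y ->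
  exists2 z, dist x z = k & dist x y = dist x z + dist z y.
Proof.
elim: k => [|k IHk] kd; first by exists x; rewrite dist_refl.
have [|z xz xy] := IHk; first exact: ltnW.
case E: (dist z y) => [|n]; first by lia.
have [u zu uy] := dist_pred E; exists u; last first.
  by have := dist_triangle u x y; have := dist_triangle z x u;
     rewrite (dist_adjE zu); lia.
by have := dist_triangle u x y; have := dist_triangle z x u;
   rewrite (dist_adjE zu); lia.
Qed.

(** * Isomorphisms of discs *)

Section DiscIso.
Variables (X Y : graph) (x : X) (y : Y) (r : nat) (f : X -> Y).
Hypothesis iso_f : disc_iso x y r f.

Lemma disc_iso_adj u v : dist x u <= r -> dist x v <= r ->
  adj (f u) (f v) = adj u v.
Proof. by case: iso_f => _ fadj _ xu xv; apply: fadj; rewrite inE. Qed.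

Lemma disc_iso_center : f x = y. Proof. by case: iso_f. Qed.

Lemma disc_iso_sub u : dist x u <= r -> dist y (f u) <= r.
Proof. by case: iso_f => [[fsub _ _] _ _] xu; exact: fsub. Qed.

Lemma disc_iso_inj u v : dist x u <= r -> dist x v <= r -> f u = f v -> u = v.
Proof. by case: iso_f => [[_ finj _] _ _] xu xv; apply: finj; rewrite inE. Qed.

Lemma disc_iso_surj v : dist y v <= r -> exists2 u, dist x u <= r & f u = v.
Proof. by case: iso_f => [[_ _ fsurj] _ _] yv; case: (fsurj v yv) => u; exists u. Qed.

Lemma disc_iso_nonexp u v : dist x u + dist u v <= r ->
  dist (f u) (f v) <= dist u v.
Proof.
move E: (dist u v) => n; elim: n v E => [|n IHn] v uv xu.
  by rewrite (dist_eq0 uv) dist_refl.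
have [z zv uz] := dist_predr uv.
have xz := dist_triangle u x z; have xv := dist_triangle u x v.
have fzv : adj (f z) (f v) by rewrite disc_iso_adj //; lia.
have := dist_triangle (f z) (f u) (f v).
by have := IHn z uz; have := dist_adj fzv; lia.
Qed.

Lemma disc_iso_lift u v s : dist x u + s <= r -> dist (f u) v <= s ->
  exists2 w, dist u w <= dist (f u) v & f w = v.
Proof.
move=> xu; move E: (dist (f u) v) => n; elim: n v E => [|n IHn] v uv ns.
  by exists u; [rewrite dist_refl | exact: dist_eq0].
have [z zv uz] := dist_predr uv.
have [|w uw fw] := IHn z uz; first exact: ltnW.
have yu : dist y (f u) <= dist x u.
  by rewrite -disc_iso_center; apply: disc_iso_nonexp; rewrite dist_refl; lia.
have yv := dist_triangle (f u) y v.
have [|t xt ft] := disc_iso_surj (v := v); first by lia.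
exists t => //; have xw := dist_triangle u x w.
have wt : adj w t by rewrite -disc_iso_adj ?fw ?ft //; lia.
by have := dist_triangle w u t; have := dist_adj wt; lia.
Qed.

Lemma disc_iso_dist u v : dist x u + dist u v <= r ->
  dist (f u) (f v) = dist u v.
Proof.
move=> xuv; apply/eqP; rewrite eqn_leq disc_iso_nonexp //=.
have [|w uw fw] := disc_iso_lift (v := f v) xuv; first exact: disc_iso_nonexp.
have le := disc_iso_nonexp xuv; suff <- : w = v by rewrite fw.
by apply: disc_iso_inj fw; [have := dist_triangle u x w | have := dist_triangle u x v];
   lia.
Qed.

(** Geodesics issued from the center of a smaller disc inside do not leave the
    large disc, neither in the source nor in the target. *)
Lemma disc_iso_shift u s : dist x u + s <= r -> disc_iso u (f u) s f.
Proof.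
move=> xus; split=> //.
  split.
  - by move=> v; rewrite /disc /= => uv; rewrite disc_iso_dist //; lia.
  - move=> v w; rewrite !inE /disc /= => uv uw; apply: disc_iso_inj.
      by have := dist_triangle u x v; lia.
    by have := dist_triangle u x w; lia.
  - move=> v; rewrite /disc /= => uv; have [w uw fw] := disc_iso_lift xus uv.
    by exists w => //=; lia.
move=> v w; rewrite !inE /disc /= => uv uw; apply: disc_iso_adj.
  by have := dist_triangle u x v; lia.
by have := dist_triangle u x w; lia.
Qed.

End DiscIso.

Lemma disc_iso_comp (X Y T : graph) (x : X) (y : Y) (t : T) r f g :
  disc_iso x y r f -> disc_iso y t r g -> disc_iso x t r (g \o f).
Proof.
move=> If Ig; split; last by rewrite /= (disc_iso_center If) (disc_iso_center Ig).
- split.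
  + by move=> u xu; apply: (disc_iso_sub Ig); apply: (disc_iso_sub If).
  + move=> u v /[!inE] /= xu xv fuv; apply: (disc_iso_inj If) => //.
    by apply: (disc_iso_inj Ig) => //; exact: (disc_iso_sub If).
  + move=> v tv; have [w yw gw] := disc_iso_surj Ig tv.
    by have [u xu fu] := disc_iso_surj If yw; exists u; rewrite //= fu.
- move=> u v /[!inE] xu xv /=.
  by rewrite (disc_iso_adj Ig) ?(disc_iso_adj If) //; apply: (disc_iso_sub If).
Qed.

Lemma disc_iso_inv (X Y : graph) (x : X) (y : Y) r f : disc_iso x y r f ->
  exists2 g : Y -> X, disc_iso y x r g &
    (forall v, dist y v <= r -> f (g v) = v).
Proof.
move=> If; have inv v : {u | dist y v <= r -> dist x u <= r /\ f u = v}.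
  case: (asboolP (dist y v <= r)) => [yv|nyv]; last by exists x.
  by have [u xu fu] := cid2 (disc_iso_surj If yv); exists u.
pose g v := sval (inv v).
have gP v : dist y v <= r -> dist x (g v) <= r /\ f (g v) = v by exact: (svalP (inv v)).
exists g => [|v /gP[]//]; split.
- split.
  + by move=> v yv; case: (gP v yv).
  + move=> v w /[!inE] yv yw gvw.
    by case: (gP v yv) (gP w yw) => _ <- [_ <-]; rewrite gvw.
  + move=> u xu; have yu := disc_iso_sub If xu; exists (f u) => //.
    by case: (gP _ yu) => xg; apply: (disc_iso_inj If).
- move=> v w /[!inE] yv yw.
  by case: (gP v yv) (gP w yw) => xv {2}<- [xw {2}<-]; rewrite (disc_iso_adj If).
- have yy : dist y y <= r by rewrite dist_refl.
  have xx : dist x x <= r by rewrite dist_refl.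
  case: (gP y yy) => xg; rewrite -{2}(disc_iso_center If).
  exact: (disc_iso_inj If).
Qed.

Lemma same_col_discP (X Y : graph) (m n : nat) (phi : X -> 'I_m) (psi : Y -> 'I_n)
    (x : X) (y : Y) r : same_col_disc phi psi x y r <->
  exists2 f, disc_iso x y r f &
    forall u, dist x u <= r -> psi (f u) = phi u :> nat.
Proof.
by split=> -[f If fc]; exists f => // u; [move=> xu; apply: fc; rewrite inE
  | rewrite inE; apply: fc].
Qed.

Section SameColDisc.
Variables (X Y : graph) (m n : nat) (phi : X -> 'I_m) (psi : Y -> 'I_n).

Lemma same_col_disc_shift (x : X) (y : Y) r f u s : disc_iso x y r f ->
  (forall u, dist x u <= r -> psi (f u) = phi u :> nat) ->
  dist x u + s <= r -> same_col_disc phi psi u (f u) s.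
Proof.
move=> If fc xu; apply/same_col_discP; exists f; first exact: (disc_iso_shift If).
by move=> v uv; apply: fc; have := dist_triangle u x v; lia.
Qed.

Lemma same_col_disc_le (x : X) (y : Y) r s : s <= r ->
  same_col_disc phi psi x y r -> same_col_disc phi psi x y s.
Proof.
move=> sr /same_col_discP[f If fc]; rewrite -(disc_iso_center If).
by apply: (same_col_disc_shift If) => //; rewrite dist_refl.
Qed.

Lemma same_col_disc_sym (x : X) (y : Y) r :
  same_col_disc phi psi x y r -> same_col_disc psi phi y x r.
Proof.
move=> /same_col_discP[f If fc]; have [g Ig gK] := disc_iso_inv If.
apply/same_col_discP; exists g => // v yv.
by rewrite -{2}(gK v yv) fc //; exact: (disc_iso_sub Ig).
Qed.

Lemma color_iso_disc f (x : X) r : color_iso phi psi f ->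
  same_col_disc phi psi x (f x) r.
Proof.
case=> -[g fK gK] fadj fc; apply/same_col_discP; exists f => //.
have lip u v : dist (f u) (f v) <= dist u v.
  move E: (dist u v) => k; elim: k v E => [|k IHk] v uv.
    by rewrite (dist_eq0 uv) dist_refl.
  have [z zv uz] := dist_predr uv; have := dist_triangle (f z) (f u) (f v).
  by rewrite -fadj in zv; have := IHk z uz; have := dist_adj zv; lia.
have lip' u v : dist (g u) (g v) <= dist u v.
  move E: (dist u v) => k; elim: k v E => [|k IHk] v uv.
    by rewrite (dist_eq0 uv) dist_refl.
  have [z zv uz] := dist_predr uv; have := dist_triangle (g z) (g u) (g v).
  rewrite -(gK z) -(gK v) fadj in zv.
  by have := IHk z uz; have := dist_adj zv; lia.
split=> //; split.
- by move=> u; apply: leq_trans; exact: lip.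
- by move=> u v _ _; exact: (can_inj fK).
- move=> v yv; exists (g v); last exact: gK.
  by apply: leq_trans yv; rewrite -{1}(fK x); exact: lip'.
Qed.

End SameColDisc.

Lemma same_col_disc_trans (X Y T : graph) (m n k : nat) (phi : X -> 'I_m)
    (psi : Y -> 'I_n) (chi : T -> 'I_k) (x : X) (y : Y) (t : T) r :
  same_col_disc phi psi x y r -> same_col_disc psi chi y t r ->
  same_col_disc phi chi x t r.
Proof.
move=> /same_col_discP[f If fc] /same_col_discP[g Ig gc]; apply/same_col_discP.
exists (g \o f); first exact: disc_iso_comp If Ig.
by move=> u xu /=; rewrite gc ?fc //; exact: (disc_iso_sub If).
Qed.

(** * Counting in discs and spheres *)

Definition setcard (T : choiceType) (S : set T) : nat := #|` fset_set S|%fset.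

Section Card.
Variable T : choiceType.
Implicit Types A B S : set T.

Lemma setcard_le A B : finite_set B -> A `<=` B -> setcard A <= setcard B.
Proof.
move=> fB AB; apply: fsubset_leq_card.
by rewrite -fset_set_sub //; exact: sub_finite_set fB.
Qed.

Lemma setcard_image_le (U : choiceType) (f : T -> U) A : finite_set A ->
  setcard (f @` A) <= setcard A.
Proof. by move=> fA; rewrite /setcard fset_set_image // leq_imfset_card. Qed.

Lemma setcard_bij (U : choiceType) (f : T -> U) A (B : set U) : finite_set A ->
  set_bij A B f -> setcard A = setcard B.
Proof.
move=> fA [fAB finj fsurj]; suff -> : B = f @` A.
  rewrite /setcard fset_set_image // card_in_imfset //= => x y.
  by rewrite !in_fset_set // => xA yA; exact: finj.
by apply/seteqP; split=> [y /fsurj[x Ax <-]|y [x Ax <-]]; [exists x | exact: fAB].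
Qed.

Lemma setcard_gt0 A x : finite_set A -> A x -> 0 < setcard A.
Proof.
move=> fA Ax; rewrite /setcard cardfs_gt0; apply/fset0Pn; exists x.
by rewrite in_fset_set // inE.
Qed.

Lemma setcardD1_lt A x : finite_set A -> A x -> setcard (A `\ x) < setcard A.
Proof.
move=> fA Ax; rewrite /setcard fset_setD1 // (cardfsD1 x (fset_set A)).
by rewrite in_fset_set // mem_set //= add1n ltnS.
Qed.

Lemma setcard_seq_cover (I : Type) (s : seq I) (B : I -> set T) (k : nat) S :
  finite_set S -> (forall i, finite_set (B i) /\ setcard (B i) <= k) ->
  (forall x, S x -> exists2 n, n < size s & exists2 i, onth s n = Some i & B i x) ->
  setcard S <= size s * k.
Proof.
move=> + Bk; elim: s S => [|i s IHs] S fS cov.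
  suff -> : S = set0 by rewrite /setcard fset_set0.
  by rewrite -subset0 => x /cov[].
have [fB kB] := Bk i.
have fD : finite_set (S `\` B i) by exact: finite_setD.
rewrite /= mulSn -(setUIDK S (B i)) /setcard fset_setU; last 2 first.
- by apply: sub_finite_set fB => x [].
- by apply: sub_finite_set fS => x [].
rewrite cardfsU; apply: (leq_trans (leq_subr _ _)); apply: leq_add.
  by apply: leq_trans kB; apply: setcard_le => // x [].
apply: IHs => // x [Sx nBx]; have [[|n] /= ns [j sj Bj]] := cov x Sx.
  by case: sj => ij; case: nBx; rewrite ij.
by exists n => //; exists j.
Qed.

Lemma setcard_cover (I : choiceType) (A : set I) (B : I -> set T) (k : nat) S :
  finite_set A -> finite_set S ->
  (forall i, A i -> finite_set (B i) /\ setcard (B i) <= k) ->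
  (forall x, S x -> exists2 i, A i & B i x) -> setcard S <= setcard A * k.
Proof.
move=> fA fS Bk cov; pose B' i := [set x | A i /\ B i x].
have := @setcard_seq_cover I (enum_fset (fset_set A)) B' k S fS; apply.
  move=> i; have [Ai|nAi] := pselect (A i).
    have [fB kB] := Bk i Ai; have -> // : B' i = B i.
    by apply/seteqP; split=> x // -[].
  have -> : B' i = set0 by rewrite -subset0 => x [].
  by rewrite /setcard fset_set0.
move=> x /cov[i Ai Bi].
have iA : i \in enum_fset (fset_set A) by rewrite in_fset_set // inE.
exists (index i (enum_fset (fset_set A))); first by rewrite index_mem.
by exists i => //; rewrite onthE (nth_map i) ?index_mem // nth_index.
Qed.

Lemma setcard_subset A n : finite_set A -> n <= setcard A ->
  exists2 B, B `<=` A & setcard B = n.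
Proof.
move=> fA nA; pose s := take n (enum_fset (fset_set A)).
have us : uniq s by apply: take_uniq; exact: fset_uniq.
exists [set` s] => [x /= xs|]; last first.
  have -> : [set` s] = [set` [fset x in s]%fset].
    by apply/seteqP; split=> x /=; rewrite !inE.
  by rewrite /setcard set_fsetK card_fseq undup_id // size_takel.
by have := mem_take xs; rewrite in_fset_set // inE.
Qed.

End Card.

Section Growth.
Variable X : graph.
Implicit Types x y : X.

Definition sphere (x : X) (r : nat) : set X := [set y | dist x y = r].

Lemma disc_finite x r : finite_set (disc x r).
Proof.
elim: r => [|r IHr].
  apply: (@sub_finite_set _ _ [set x]) => [y|]; last exact: finite_set1.
  by rewrite /disc /= leqn0 => /eqP/dist_eq0.
apply: (@sub_finite_set _ _
  (disc x r `|` \bigcup_(z in disc x r) [set y | adj z y])); last first.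
  rewrite finite_setU; split=> //; apply: bigcup_finite => // z _.
  exact: adj_fin.
move=> y; rewrite /disc /= leq_eqVlt => /orP[/eqP xy|]; last by rewrite ltnS; left.
by right; have [z zy xz] := dist_predr xy; exists z; rewrite /= ?xz.
Qed.

Lemma sphere_finite x r : finite_set (sphere x r).
Proof. by apply: sub_finite_set (disc_finite x r) => y; rewrite /disc /sphere /= => ->. Qed.

Hint Resolve disc_finite sphere_finite : core.

Hypothesis Xinfinite : infinite_set [set: X].

Lemma sphere_neq0 x r : exists y, dist x y = r.
Proof.
have [y ry] : exists y, r < dist x y.
  apply/not_existsP => far; apply: Xinfinite; apply: sub_finite_set (disc_finite x r).
  by move=> y _; rewrite /disc /= leqNgt; apply/negP/far.
by have [z xz _] := dist_between (ltnW ry); exists z.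
Qed.

Variable D : nat.
Hypothesis degD : forall x, degree x <= D.

Lemma setcard_disc_add x r s k : (forall u, dist x u <= r -> setcard (disc u s) <= k) ->
  setcard (disc x (r + s)) <= setcard (disc x r) * k.
Proof.
move=> uk; apply: (setcard_cover (B := fun u => disc u s)) => [//|//|u /uk//|].
move=> y; rewrite /disc /= => xy; have [xr|rx] := leqP (dist x y) r.
  by exists y; rewrite // dist_refl.
have [z xz xyE] := dist_between (ltnW rx).
by exists z; rewrite /disc /=; lia.
Qed.

Lemma setcard_disc1 x : setcard (disc x 1) <= D.+1.
Proof.
have : finite_set (x |` [set y | adj x y]).
  by rewrite finite_setU; split; [exact: finite_set1 | exact: adj_fin].
move=> fN; apply: (@leq_trans (setcard (x |` [set y | adj x y]))).
  apply: setcard_le => // y; rewrite /disc /=; case E: (dist x y) => [|[|//]] _.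
    by left; rewrite (dist_eq0 E).
  by right; exact: adj_dist.
rewrite /setcard fset_setU1; last exact: adj_fin.
by rewrite cardfsU1; have := degD x; rewrite /degree; case: (_ \notin _); lia.
Qed.

Lemma setcard_disc x r : setcard (disc x r) <= D.+1 ^ r.
Proof.
elim: r => [|r IHr].
  rewrite expn0 -[1](cardfs1 x) -fset_set1; apply: setcard_le; first exact: finite_set1.
  by move=> y; rewrite /disc /= leqn0 => /eqP/dist_eq0.
rewrite -addn1 expnD expn1; apply: leq_trans (leq_mul IHr (leqnn _)).
by apply: setcard_disc_add => u _; exact: setcard_disc1.
Qed.

Lemma setcard_disc_muln x h k n : (forall u, dist x u <= n * h -> setcard (disc u h) <= k) ->
  setcard (disc x (n * h)) <= k ^ n.
Proof.
elim: n => [|n IHn] uk; first by rewrite mul0n expn0 (leq_trans (setcard_disc x 0)).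
rewrite mulSn addnC expnSr; apply: leq_trans (leq_mul (IHn _) (leqnn _)).
  by apply: setcard_disc_add => u xu; apply: uk; lia.
by move=> u xu; apply: uk; lia.
Qed.

Lemma setcard_sphere_add x r s :
  setcard (sphere x (r + s)) <= setcard (sphere x r) * D.+1 ^ s.
Proof.
apply: (setcard_cover (B := fun u => disc u s)) => [//|//|u _|y].
  by split=> //; exact: setcard_disc.
rewrite /sphere /= => xy; have [|z xz xyE] := @dist_between X x y r; first by lia.
by exists z; rewrite //= /disc /=; lia.
Qed.

Lemma setcard_disc_spheres x r k : (forall t, t <= r -> setcard (sphere x t) <= k) ->
  setcard (disc x r) <= r.+1 * k.
Proof.
move=> tk; have := @setcard_seq_cover X nat (iota 0 r.+1)
  (fun t => [set y | t <= r /\ dist x y = t]) k (disc x r).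
rewrite size_iota; apply => // [t|y].
  have [tr|rt] := leqP t r; last first.
    have -> : [set y | false /\ dist x y = t] = set0 by rewrite -subset0 => y [].
    by rewrite /setcard fset_set0.
  have -> : [set y | true /\ dist x y = t] = sphere x t.
    by apply/seteqP; split=> y; [case|].
  by split; [|exact: tk].
rewrite /disc /= => xy; exists (dist x y); first by rewrite ltnS.
exists (dist x y) => //; have lt : dist x y < r.+1 by rewrite ltnS.
rewrite -[_ :: _]/(iota 0 r.+1) onthE (nth_map 0) ?size_iota //.
by rewrite nth_iota.
Qed.

End Growth.

(** * Greedy choices *)

Definition separated (X : graph) (d : nat) (S : set X) :=
  forall x y, S x -> S y -> x <> y -> d < dist x y.

Lemma max_separated (X : graph) (d : nat) (S0 S : set X) : separated d S0 ->
  exists S1, [/\ S0 `<=` S1, S1 `<=` S0 `|` S, separated d S1 &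
    forall x, S x -> exists2 y, S1 y & dist x y <= d].
Proof.
move=> sep0; pose P (B : set X) := B `<=` S /\ separated d (S0 `|` B).
have [|B [[BS sepB] maxB]] := @Zorn_bigcup X P.
  move=> F FP Ftot; split; first by move=> x [B FB Bx]; case: (FP B FB) => + _; apply.
  move=> x y [x0|[B FB Bx]] [y0|[B' FB' By]] xy.
  - exact: sep0.
  - case: (FP B' FB') => _ sepB'; exact: (sepB' x y (or_introl x0) (or_intror By)).
  - case: (FP B FB) => _ sepB; exact: (sepB x y (or_intror Bx) (or_introl y0)).
  - case: (Ftot _ _ FB FB') => BB.
      case: (FP B' FB') => _ sepB'.
      exact: (sepB' x y (or_intror (BB x Bx)) (or_intror By)).
    case: (FP B FB) => _ sepB.
    exact: (sepB x y (or_intror Bx) (or_intror (BB y By))).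
exists (S0 `|` B); split=> //; first by apply: setUS.
move=> x Sx; apply: contrapT => nx.
have xfar y : (S0 `|` B) y -> d < dist x y.
  by move=> y1; rewrite ltnNge; apply/negP => xy; apply: nx; exists y.
have nBx : ~ B x by move=> Bx; have := xfar x (or_intror Bx); rewrite dist_refl.
apply: (maxB (B `|` [set x])).
  split; first by move=> y; left.
  by move=> /(_ x (or_intror erefl)).
split; first by move=> y [/BS//|->].
rewrite setUA => y z [y1|->] [z1|->] yz //; first exact: sepB.
  by rewrite dist_sym; exact: xfar.
exact: xfar.
Qed.

(** The vertices are treated one after the other in the order of an enumeration,
    and the ones already treated rule out too few elements to exhaust a list. *)
Lemma list_coloring (X : choiceType) (L : finType) (l0 : L) (A : set X)
    (nb : X -> X -> Prop) (lst : X -> {set L}) :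
  countable [set: X] -> (forall x y, nb x y -> nb y x) ->
  (forall a, A a -> let N := [set x | [/\ A x, x <> a & nb a x]] in
     finite_set N /\ setcard N < #|lst a|) ->
  exists lab : X -> L, (forall a, A a -> lab a \in lst a) /\
    forall a b, A a -> A b -> a <> b -> nb a b -> lab a <> lab b.
Proof.
move=> /countable_injP[idx idx_inj] nb_sym few.
have {}idx_inj x y : idx x = idx y -> x = y by apply: idx_inj; rewrite inE.
have new (g : X -> L) a : {l | A a -> l \in lst a /\
    forall x, A x -> x <> a -> nb a x -> g x <> l}.
  have [Aa|nAa] := pselect (A a); last by exists l0.
  apply: cid; have [fN cN] := few a Aa.
  pose N := [set x | [/\ A x, x <> a & nb a x]].
  pose bad : {set L} := [set l | `[< (g @` N) l >]]%SET.
  have : ~~ (lst a \subset bad).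
    apply/negP => /subset_leq_card le; have := leq_ltn_trans (setcard_image_le g fN) cN.
    rewrite ltnNge => /negP; apply; apply: leq_trans le _.
    rewrite -card_finset /setcard; apply: eq_leq; congr #|` _|%fset.
    apply/fsetP => l; rewrite in_fset_set ?in_fset ?inE; last exact: finite_image.
    by apply/idP/idP => /asboolP //; rewrite in_setE.
  move=> /subsetPn[l la lb]; exists l => _; split=> // x Ax xa nbx gx.
  by move: lb; rewrite inE => /asboolP; apply; exists x.
(* [h n] labels the vertices of index less than [n]. *)
pose upd n (h : X -> L) x := if idx x == n then sval (new h x) else h x.
pose h := fix h n := if n is n'.+1 then upd n' (h n') else fun=> l0.
pose lab x := h (idx x).+1 x.
have hlab n x : idx x < n -> h n x = lab x.
  elim: n => // n IHn; rewrite ltnS leq_eqVlt => /orP[/eqP <-//|xn].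
  by rewrite /= /upd (ltn_eqF xn) IHn.
have labE x : lab x = sval (new (h (idx x)) x) by rewrite /lab /= /upd eqxx.
exists lab; split=> [a Aa|].
  by rewrite labE; case: (svalP (new (h (idx a)) a) Aa).
suff wl a b : A a -> A b -> idx a < idx b -> nb b a -> lab a <> lab b.
  move=> a b Aa Ab ab nbab; case: (ltngtP (idx a) (idx b)) => [lt|lt|/idx_inj//].
    by apply: wl => //; exact: nb_sym.
  by move=> /esym; apply: wl.
move=> Aa Ab lt nbba; rewrite -(hlab (idx b) a lt) labE.
case: (svalP (new (h (idx b)) b) Ab) => _; apply=> // ab.
by rewrite ab ltnn in lt.
Qed.

(** This is what allows the radius of a layer to absorb the loss of capacity that
    is caused by the sparsity of its slots. *)
Lemma exp_beats_linear a m : exists q, [/\ m <= q, 0 < q & a * q.+1 <= 2 ^ q].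
Proof.
pose n := maxn m (3 * a).+1; exists (n + n).
have nm : m <= n by rewrite /n; lia.
have na : 3 * a < n by rewrite /n; lia.
have n2 := ltn_expl n (isT : 1 < 2).
split; [lia | lia | rewrite expnD]; apply: (@leq_trans (n * 2 ^ n)); nia.
Qed.

Lemma card_ord_lt (N m : nat) : m <= N -> #|[pred i : 'I_N | i < m]| = m.
Proof.
move=> mN; rewrite -[RHS]card_ord -(fintype.card_image (f := widen_ord mN)); last first.
  by move=> i j /(congr1 val) ij; apply: val_inj.
apply: eq_card => i; apply/idP/mapP => [im|[j _ ->]]; last exact: (ltn_ord j).
by exists (Ordinal im); [rewrite mem_enum | apply: val_inj].
Qed.

(** * Layers of marks *)

Definition net (X : graph) (k : nat) (S : set X) :=
  forall x, exists2 y, S y & dist x y <= k.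

(** The marker of a root [z] consists of three points on a geodesic starting at [z].
    In a layer the third one is not close to the second one, so the order of the
    three points can be recovered from their distances. *)
Definition marked (X : graph) (e : nat) (S : set X) (z : X) := exists b c,
  [/\ S b, S c, b <> z /\ c <> b, dist z b <= 3 &
      dist z c = dist z b + dist b c /\ dist z c <= e].

(** The weak form of isomorphism that already determines the labels, which only
    depend on the numbers of marks at given distances from the center. *)
Definition mark_iso (X : graph) (S : set X) (r : nat) (a a' : X) :=
  exists f : X -> X,
  [/\ set_bij (disc a r) (disc a' r) f,
      forall u, dist a u <= r -> dist a' (f u) = dist a u &
      forall u, dist a u <= r -> (S (f u) <-> S u)].

(** Markers have diameter at most [gap], and any two other marks of the layer are
    further apart; labels are encoded in the discs of radius [radius] about the
    roots; [threshold] is the cardinality from which such a disc is rich. *)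
Record layer (X : graph) := Layer {
  roots : set X;
  marks : set X;
  radius : nat;
  gap : nat;
  threshold : nat }.

Definition rich (X : graph) (l : layer X) (x : X) :=
  threshold l <= setcard (disc x (radius l)).

(** The places that remain available for the following layers. *)
Definition free (X : graph) (F : set X) (l : layer X) : set X :=
  [set x | F x /\ forall a, roots l a -> 2 * radius l < dist a x].

(** What a layer placed in [F] has to satisfy, where [prev_gap] is the gap of the
    preceding layer. By [ls_no3] the markers of this layer are too wide to be
    taken for markers of an earlier one. With radius [rho], an isomorphism that
    moves [x] by at most [rho] moves a root at distance [k * rho] from [x] by at
    most [(2 * k + 1) * rho]; therefore labels are distinct up to distance
    [3 * 11 * rho] in general and [3 * 46 * rho] for rich roots, as [ls_cover]
    gives [k = 11] or [k = 46]. The flag [base] is set for the first layer, whose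
    roots must have an adjacent mark; in the other layers marks are never so
    close, because they could then be siblings. The bound [rmin] makes the radii
    of the successive layers tend to infinity. *)
Record layer_spec (X : graph) (F : set X) (prev_gap rmin : nat) (base : bool)
    (l : layer X) : Prop := LayerSpec {
  ls_gap : prev_gap <= gap l;
  ls_radius : gap l + 10 <= radius l /\ rmin <= radius l;
  ls_roots_marks : roots l `<=` marks l;
  ls_marksF : forall z, marks l z -> exists2 y, F y & dist z y <= 3;
  ls_marks_near : forall z, marks l z -> exists2 a, roots l a & dist a z <= radius l;
  ls_no3 : forall x y z, marks l x -> marks l y -> marks l z ->
    x <> y -> y <> z -> x <> z -> dist x y <= prev_gap -> dist y z <= prev_gap ->
    prev_gap < dist x z;
  ls_marked : forall a, roots l a -> marked (gap l) (marks l) a;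
  ls_markedK : forall z, marks l z -> marked (gap l) (marks l) z -> roots l z;
  ls_close : forall x y, marks l x -> marks l y -> x <> y -> dist x y <= 2 ->
    base /\ (roots l x \/ roots l y);
  ls_partner : base -> forall a, roots l a -> exists2 z, marks l z & adj a z;
  ls_cover : forall x, (exists2 a, roots l a & dist x a <= 11 * radius l) \/
    (exists a, [/\ roots l a, rich l a & dist x a <= 46 * radius l]);
  ls_distinct : forall a a', roots l a -> roots l a' -> a <> a' ->
    mark_iso (marks l) (radius l) a a' ->
    33 * radius l < dist a a' /\ (rich l a -> 138 * radius l < dist a a');
  ls_free : exists k, net k (free F l) }.

Section LayerConstruction.
Variable X : graph.
Hypothesis Xinfinite : infinite_set [set: X].
Variable D : nat.
Hypothesis degD : forall x : X, degree x <= D.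
Variables (F : set X) (hole prev_gap rmin : nat) (base : bool).
Hypothesis netF : net hole F.

Definition partner_dist := if base then 1 else 3.
Definition marker_width := 2 * hole + prev_gap + 8.

Lemma partner_dist_bounds : 1 <= partner_dist <= 3.
Proof. by rewrite /partner_dist; case: base. Qed.

(** Any vertex [a] can carry a marker [a], [bc.1], [bc.2]. Only [bc.2] has to be
    free since [bc.1] is so close to [a]. *)
Lemma triple_exists a : exists bc : X * X,
  [/\ F bc.2, dist a bc.1 = partner_dist, dist a bc.2 = partner_dist + dist bc.1 bc.2 &
      prev_gap + 8 <= dist a bc.2 <= marker_width].
Proof.
have [x ax] := sphere_neq0 Xinfinite a (hole + prev_gap + 8).
have [c Fc xc] := netF x; have := dist_triangle x a c; have := dist_triangle c a x.
rewrite (dist_sym c x) => h1 h2.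
have [|b ab abc] := @dist_between X a c partner_dist.
  by have := partner_dist_bounds; lia.
by exists (b, c); rewrite -ab; split=> //; apply/andP; split; rewrite /marker_width /=; lia.
Qed.

Variables (b c : X -> X).
Hypothesis bcP : forall a, [/\ F (c a), dist a (b a) = partner_dist,
  dist a (c a) = partner_dist + dist (b a) (c a) &
  prev_gap + 8 <= dist a (c a) <= marker_width].

Variable P : set X.
Hypotheses (sepP : separated marker_width P) (PF : P `<=` F).
Hypothesis netP : net (hole + marker_width) P.

(** The slots form a net of radius [hole + marker_width], so shells of this width
    contain slots near each point of their middle sphere. *)
Definition width := 2 * (hole + marker_width) + 1.

(** With this value [2 ^ (q * num_shells)] bounds the cardinality of the discs of
    radius [138 * rho]. *)
Definition num_shells := D * (138 * 71 * width).

(** The cardinality of a sphere is at most [loss] times the number of slots of any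
    shell that lies at most [num_shells] shells further in. *)
Definition loss := D.+1 ^ ((hole + marker_width) + num_shells.+1 * width).

Variable q : nat.
Hypotheses (q_rmin : rmin <= q) (q_gt0 : 0 < q).
Hypothesis q_big : 71 * width * loss * q.+1 <= 2 ^ q.

Definition depth := 70 * q + 1.
Definition rho := depth * width.

Lemma widthE : width = 2 * (hole + marker_width) + 1. Proof. by []. Qed.
Lemma width_gt0 : 0 < width. Proof. by rewrite /width; lia. Qed.
Lemma width_ge : 2 * marker_width + 1 <= width /\ 2 * hole <= width.
Proof. by rewrite /width; lia. Qed.
Lemma marker_width_ge : 8 + prev_gap <= marker_width.
Proof. by rewrite /marker_width; lia. Qed.
Lemma rho_ge : 71 * width <= rho. Proof. by rewrite /rho /depth; move: width q_gt0; nia. Qed.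
Lemma rho_gt_q : q <= rho.
Proof. by rewrite /rho /depth; move: width_gt0; move: width; nia. Qed.
Lemma rho_le : rho <= 71 * q * width. Proof. by rewrite /rho /depth; move: width; nia. Qed.

Definition shell (a : X) (k : nat) : set X :=
  [set x | k * width <= dist a x < k.+1 * width].

Definition slots (a : X) (k : nat) : set X := P `&` shell a k.

Lemma shell_lt a k x : k < depth -> shell a k x -> dist a x < rho.
Proof.
move=> kK /andP[_ /leq_trans]; apply; by rewrite /rho leq_mul2r kK orbT.
Qed.

Lemma shell_ge a k x : 0 < k -> shell a k x -> width <= dist a x.
Proof. by case: k => // k _ /andP[+ _]; rewrite mulSn; lia. Qed.

Lemma slots_finite a k : finite_set (slots a k).
Proof.
apply: sub_finite_set (disc_finite a (k.+1 * width)) => x [_ /andP[_ /ltnW]].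
exact.
Qed.

(** Each vertex in the middle of a shell has a slot of the same shell nearby, and
    a slot serves only the vertices of a disc of bounded radius. *)
Lemma sphere_slots a k :
  setcard (sphere a (k * width + (hole + marker_width))) <=
  setcard (slots a k) * D.+1 ^ (hole + marker_width).
Proof.
apply: (setcard_cover (B := fun u => disc u (hole + marker_width))).
- exact: slots_finite.
- exact: sphere_finite.
- by move=> u _; split; [exact: disc_finite | exact: setcard_disc].
move=> x; rewrite /sphere /= => ax; have [u Pu xu] := netP x.
exists u; last by rewrite /disc /= dist_sym.
split=> //; rewrite /shell /=.
have := dist_triangle x a u; have := dist_triangle u a x; rewrite (dist_sym u x).
by rewrite mulSn; have := widthE; lia.
Qed.

Lemma slots_gt0 a k : 0 < setcard (slots a k).
Proof.
have [x ax] := sphere_neq0 Xinfinite a (k * width + (hole + marker_width)).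
have := sphere_slots a k.
have : 0 < setcard (sphere a (k * width + (hole + marker_width))).
  by apply: (setcard_gt0 (x := x)) => //; exact: sphere_finite.
by case: (setcard (slots a k)) => //; lia.
Qed.

Lemma slots_le a k : k < depth -> setcard (slots a k) <= D.+1 ^ rho.
Proof.
move=> kK; apply: leq_trans (setcard_disc degD a rho); apply: setcard_le.
  exact: disc_finite.
by move=> x [_ /(shell_lt kK)]; exact: ltnW.
Qed.

(** The number of values available for the [k]-th coordinate of a label of [a]. The
    innermost shell is not used, since it contains the marker of [a]. *)
Definition capacity (a : X) (k : nat) :=
  if k == 0 then 1 else (setcard (slots a k)).+1.

(** Every shell except the innermost one contributes at least one bit, because
    the spheres of an infinite graph are not empty. *)
Lemma capacity_small a : 2 ^ (70 * q) <= \prod_(k < depth) capacity a k.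
Proof.
rewrite /depth addn1 big_ord_recl /= mul1n -[X in _ ^ X]card_ord -prod_nat_const.
by apply: leq_prod => i _; rewrite /capacity /= ltnS slots_gt0.
Qed.

(** A disc with exponentially many vertices has a sphere with exponentially
    many vertices; the spheres just below that one are still large, because
    passing to the next sphere multiplies cardinalities at most by [D.+1]. So
    there are [num_shells] consecutive shells with at least [2 ^ q] slots. *)
Lemma capacity_rich a : 2 ^ (2 * q) <= setcard (disc a rho) ->
  2 ^ (q * num_shells) <= \prod_(k < depth) capacity a k.
Proof.
move=> big_a.
have rhoC : rho.+1 * loss <= 2 ^ q.
  apply: leq_trans q_big; rewrite mulnAC leq_mul2r.
  by apply/orP; right; rewrite /rho /depth; move: width width_gt0; nia.
have [t [trho tbig]] : exists t, t <= rho /\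
    2 ^ (2 * q) <= rho.+1 * setcard (sphere a t).
  apply: contrapT => none.
  have small t : t <= rho -> setcard (sphere a t) <= (2 ^ (2 * q)).-1 %/ rho.+1.
    move=> trho; rewrite leq_divRL // -ltnS prednK ?expn_gt0 // mulnC ltnNge.
    by apply/negP => tb; apply: none; exists t.
  have := setcard_disc_spheres small; rewrite mulnC => /leq_trans/(_ (leq_divM _ _)).
  move=> /(leq_trans big_a); rewrite leqNgt prednK ?leqnn ?expn_gt0 //.
(* The sphere of radius [t] is contained in the shell of index [k1]. *)
pose k1 := t %/ width; have w0 := width_gt0.
have k1t : k1 * width <= t by exact: leq_divM.
have tk1 : t < k1.+1 * width by rewrite -ltn_divLR.
have k1K : k1 <= depth by rewrite /k1; apply: leq_trans (leq_div2r _ trho) _; rewrite mulnK.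
have Mk1 : num_shells < k1.
  rewrite ltnNge; apply/negP => k1M.
  have tC : setcard (sphere a t) <= loss.
    apply: leq_trans (leq_trans (setcard_disc degD a t) _).
      by apply: setcard_le; [exact: disc_finite | move=> x; rewrite /disc /sphere /= => ->].
    apply: leq_pexp2l => //; apply: leq_trans (ltnW tk1) _.
    by apply: leq_trans _ (leq_addl _ _); rewrite leq_mul2r ltnS k1M orbT.
  have := leq_trans tbig (leq_trans (leq_mul (leqnn _) tC) rhoC).
  by rewrite leq_exp2l // mul2n -addnn; lia.
have large k : k1 - num_shells <= k < k1 -> 2 ^ q <= setcard (slots a k).
  move=> /andP[kge klt].
  have kt : k * width + (hole + marker_width) <= t.
    apply: leq_trans k1t; apply: (@leq_trans (k.+1 * width)).
      by rewrite mulSn; have := widthE; lia.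
    by rewrite leq_mul2r klt orbT.
  have tk : t - (k * width + (hole + marker_width)) <= num_shells.+1 * width.
    rewrite leq_subLR; apply: (leq_trans (ltnW tk1)).
    apply: (@leq_trans (k * width + num_shells.+1 * width)); last by lia.
    by rewrite -mulnDl leq_mul2r; apply/orP; right; lia.
  have := setcard_sphere_add degD a (k * width + (hole + marker_width))
    (t - (k * width + (hole + marker_width))).
  rewrite subnKC // => ht.
  have hp := sphere_slots a k.
  have sl : setcard (sphere a t) <= setcard (slots a k) * loss.
    apply: leq_trans ht _; apply: leq_trans (leq_mul hp (leqnn _)) _.
    have hC : D.+1 ^ (hole + marker_width) *
        D.+1 ^ (t - (k * width + (hole + marker_width))) <= loss.
      by rewrite -expnD; apply: leq_pexp2l => //; rewrite leq_add2l.
    by rewrite -[X in X <= _]mulnA; apply: leq_mul.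
  have h : 2 ^ q * 2 ^ q <= setcard (slots a k) * 2 ^ q.
    rewrite -expnD addnn -mul2n; apply: leq_trans tbig _.
    apply: leq_trans (leq_mul (leqnn _) sl) _.
    by rewrite mulnCA leq_mul2l rhoC orbT.
  by rewrite leq_pmul2r ?expn_gt0 in h.
rewrite -(big_mkord xpredT (capacity a)) expnM.
have k1M : k1 - num_shells <= k1 by lia.
rewrite (big_cat_nat (n := k1 - num_shells)) /= ?leq0n //; last by lia.
rewrite (big_cat_nat (n := k1) (m := k1 - num_shells)) //=.
have pos m n : 0 < \prod_(m <= k < n) capacity a k.
  by apply: prodn_cond_gt0 => k _; rewrite /capacity; case: ifP.
apply: leq_trans _ (leq_pmull _ (pos _ _)); apply: leq_trans _ (leq_pmulr _ (pos _ _)).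
have -> : (2 ^ q) ^ num_shells = \prod_(k1 - num_shells <= k < k1) 2 ^ q.
  by rewrite prod_nat_const_nat; congr (_ ^ _); lia.
rewrite big_nat_cond [X in _ <= X]big_nat_cond.
apply: leq_prod => k /andP[hk _]; rewrite /capacity.
by case: eqP => [k0|_]; [move: hk; rewrite k0; lia | apply: leqW; exact: large].
Qed.

Variable A : set X.
Hypotheses (AF : A `<=` F) (sepA : separated (10 * rho) A).

Definition rich_disc (a : X) : bool := 2 ^ (2 * q) <= setcard (disc a rho).

Hypothesis A_kinds : forall a, A a ->
  rich_disc a \/ setcard (disc a (33 * rho)) <= 2 ^ (70 * q).
Hypothesis A_rich : forall x, F x -> rich_disc x ->
  exists a, [/\ A a, rich_disc a & dist x a <= 10 * rho].
Hypothesis A_small : forall x, F x -> setcard (disc x (33 * rho)) <= 2 ^ (70 * q) ->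
  exists2 a, A a & dist x a <= 10 * rho.

Definition conflict_range (a : X) := if rich_disc a then 138 * rho else 33 * rho.

Definition conflict (a a' : X) :=
  rich_disc a = rich_disc a' /\ dist a a' <= conflict_range a.

Lemma conflict_sym a a' : conflict a a' -> conflict a' a.
Proof. by case=> ab; rewrite /conflict /conflict_range ab dist_sym. Qed.

(** For a rich root, [num_shells] is adapted to the size of the discs of radius
    [138 * rho]; for the other roots, the discs of radius [33 * rho] are small by
    assumption. *)
Lemma few_conflicts a : A a -> let S := [set x | [/\ A x, x <> a & conflict a x]] in
  finite_set S /\ setcard S < \prod_(k < depth) capacity a k.
Proof.
move=> Aa S; have NR : S `<=` disc a (conflict_range a) `\ a.
  by move=> x [Ax xa [_ ax]]; split=> // /esym.
have fR : finite_set (disc a (conflict_range a) `\ a).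
  by apply: finite_setD; exact: disc_finite.
split; first exact: sub_finite_set fR.
apply: leq_ltn_trans (setcard_le fR NR) _.
apply: leq_trans (setcardD1_lt _ _) _; first exact: disc_finite.
  by rewrite /disc /= dist_refl.
rewrite /conflict_range; case: ifPn => [ba|nba]; last first.
  case: (A_kinds Aa) => [ba|sa]; first by rewrite ba in nba.
  exact: leq_trans sa (capacity_small a).
apply: leq_trans (capacity_rich ba).
apply: leq_trans (setcard_disc degD a _) _.
apply: (@leq_trans ((2 ^ D) ^ (138 * rho))).
  have rho0 : 0 < 138 * rho by have := rho_ge; have := width_gt0; lia.
  by rewrite (leq_exp2r _ _ rho0); exact: ltn_expl.
rewrite -expnM leq_exp2l // /num_shells.
have -> : q * (D * (138 * 71 * width)) = D * (138 * (71 * q * width)) by lia.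
by rewrite !leq_mul2l rho_le !orbT.
Qed.

Definition label_bound := (D.+1 ^ rho).+1.

Definition labels (a : X) : {set {ffun 'I_depth -> 'I_label_bound}} :=
  [set l : {ffun 'I_depth -> 'I_label_bound} | [forall k : 'I_depth, l k < capacity a k]].

Lemma card_labels a : #|labels a| = \prod_(k < depth) capacity a k.
Proof.
have -> : #|labels a| =
    #|(family (fun k : 'I_depth => [pred i : 'I_label_bound | i < capacity a k]))|.
  by rewrite cardsE; apply: eq_card => l; apply/forallP/familyP => h k; exact: h.
rewrite card_family foldrE big_map big_enum /=; apply: eq_bigr => k _.
apply: card_ord_lt; rewrite /capacity; case: ifP => // _; rewrite ltnS.
exact: slots_le.
Qed.

Variable lab : X -> {ffun 'I_depth -> 'I_label_bound}.
Hypothesis lab_in : forall a, A a -> lab a \in labels a.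
Hypothesis lab_neq : forall a a', A a -> A a' -> a <> a' -> conflict a a' ->
  lab a <> lab a'.
Variable s : X -> 'I_depth -> set X.
Hypothesis sP : forall a k, A a -> s a k `<=` slots a k /\ setcard (s a k) = lab a k.

Definition triple (a z : X) := [\/ z = a, z = b a | z = c a].
Definition mark_of (a z : X) := triple a z \/ exists k, s a k z.
Definition all_marks : set X := [set z | exists2 a, A a & mark_of a z].

Lemma triple_dist a z : triple a z -> dist a z <= marker_width.
Proof.
have [_ ab _ /andP[_ ac]] := bcP a; have dl := partner_dist_bounds; have ee := marker_width_ge.
by case=> ->; rewrite ?dist_refl ?ab //; lia.
Qed.

Lemma bit_dist a k z : A a -> s a k z -> width <= dist a z < rho.
Proof.
move=> Aa skz; have [sub cs] := sP k Aa; have [_ sh] := sub z skz.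
rewrite (shell_lt (ltn_ord k) sh) andbT; apply: (shell_ge _ sh).
have : 0 < lab a k.
  by rewrite -cs; apply: setcard_gt0 skz; apply: sub_finite_set (slots_finite a k).
have := lab_in Aa; rewrite inE => /forallP/(_ k); rewrite /capacity.
by case: (nat_of_ord k) => //=; lia.
Qed.

Lemma mark_of_dist a z : A a -> mark_of a z -> dist a z < rho.
Proof.
move=> Aa [/triple_dist|[k /(bit_dist Aa)/andP[]//]].
by have := rho_ge; have := width_ge; lia.
Qed.

Lemma mark_of_eq a a' z z' : A a -> A a' -> mark_of a z -> mark_of a' z' ->
  dist z z' <= rho -> a = a'.
Proof.
move=> Aa Aa' /(mark_of_dist Aa) az /(mark_of_dist Aa') az' zz'.
apply: contrapT => /(sepA Aa Aa').
have := dist_triangle z a a'; have := dist_triangle z' z a'.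
by rewrite (dist_sym z' a'); lia.
Qed.

(** The bits of a root are far from each other, and also from its marker because
    they avoid the innermost shell. *)
Lemma close_triple a z z' : A a -> mark_of a z -> mark_of a z' -> z <> z' ->
  dist z z' <= marker_width -> triple a z.
Proof.
have we := width_ge; move=> Aa [//|[k sz]] mz' zz' dz; exfalso; case: mz' => [tz'|[k' sz']].
  have /andP[wz _] := bit_dist Aa sz; have := triple_dist tz'.
  by have := dist_triangle z' a z; rewrite (dist_sym z' z); lia.
have [sub _] := sP k Aa; have [sub' _] := sP k' Aa.
have [Pz _] := sub _ sz; have [Pz' _] := sub' _ sz'.
by have := sepP Pz Pz' zz'; lia.
Qed.

Lemma triple_pair a z z' : triple a z -> triple a z' -> z <> z' ->
  dist z z' <= prev_gap + 4 -> (z = a /\ z' = b a) \/ (z = b a /\ z' = a).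
Proof.
have [_ ab abc /andP[ac _]] := bcP a; have dl := partner_dist_bounds.
case=> -> [] -> // _; rewrite 1?(dist_sym (c a)); by [left|right|lia].
Qed.

Lemma all_marks_close x y : all_marks x -> all_marks y -> x <> y ->
  dist x y <= marker_width -> exists a, [/\ A a, triple a x & triple a y].
Proof.
move=> [a Aa ax] [a' Aa' ay] xy dxy.
have [we _] := width_ge; have re := rho_ge.
have eaa : a' = a by apply/esym; apply: (mark_of_eq Aa Aa' ax ay); lia.
rewrite eaa in ay; exists a; split=> //; first exact: close_triple ay xy dxy.
apply: (close_triple Aa ay ax); first by move=> /esym.
by rewrite dist_sym.
Qed.

Lemma triple_eq a a' z : A a -> A a' -> triple a z -> triple a' z -> a = a'.
Proof.
move=> Aa Aa' tz tz'; apply: (mark_of_eq (z := z) (z' := z) Aa Aa'); try by left.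
by rewrite dist_refl.
Qed.

Lemma root_mark a : A a -> all_marks a.
Proof. by move=> Aa; exists a => //; left; constructor 1. Qed.

Lemma shell_inj a k k' x : shell a k x -> shell a k' x -> k = k'.
Proof.
suff h n m : shell a n x -> shell a m x -> n <= m.
  by move=> hk hk'; apply/eqP; rewrite eqn_leq !h.
move=> /andP[nx _] /andP[_ xm]; rewrite -ltnS -(ltn_pmul2r width_gt0).
exact: leq_ltn_trans nx xm.
Qed.

Lemma marks_shell a (k : 'I_depth) : A a -> 0 < k -> all_marks `&` shell a k = s a k.
Proof.
move=> Aa k0; apply/seteqP; split=> [z [[a' Aa' mz] sh]|z sz]; last first.
  by have [sub _] := sP k Aa; have [_ sh] := sub z sz; split=> //; exists a => //; right; exists k.
have az := shell_lt (ltn_ord k) sh.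
have eaa : a' = a.
  apply: (mark_of_eq (z' := a) Aa' Aa mz); first by left; constructor 1.
  by rewrite dist_sym; exact: ltnW.
rewrite eaa in mz; case: mz => [/triple_dist|[k' sz]].
  by have := shell_ge k0 sh; have := width_ge; lia.
suff -> : k = k' by [].
have [sub _] := sP k' Aa; have [_ sh'] := sub z sz.
by apply: val_inj; exact: shell_inj sh sh'.
Qed.

(** Labels can be read off from the numbers of marks in the shells: discs of
    different roots are disjoint, and the innermost shell carries no bit. *)
Lemma mark_iso_label a a' : A a -> A a' -> mark_iso all_marks rho a a' ->
  rich_disc a = rich_disc a' /\ lab a = lab a'.
Proof.
move=> Aa Aa' [f [fbij fdist fmark]]; split.
  by rewrite /rich_disc (setcard_bij _ fbij) //; exact: disc_finite.
apply/ffunP => k; apply: val_inj => /=.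
have [k0|k0] := posnP k.
  have := lab_in Aa; have := lab_in Aa'; rewrite !inE.
  by move=> /forallP/(_ k) + /forallP/(_ k); rewrite /capacity k0 /=; lia.
have [_ <-] := sP k Aa; have [_ <-] := sP k Aa'.
rewrite -(marks_shell Aa k0) -(marks_shell Aa' k0).
apply: (setcard_bij (f := f)).
  rewrite (marks_shell Aa k0); have [sub _] := sP k Aa.
  by apply: sub_finite_set sub _; exact: slots_finite.
have sh_rho x y : shell x k y -> dist x y <= rho by move/(shell_lt (ltn_ord k))/ltnW.
case: fbij => fsub finj fsurj; split.
- move=> x [mx sx]; have ax := sh_rho _ _ sx; split; first exact/fmark.
  by rewrite /shell /= fdist.
- move=> x y; rewrite !inE => -[_ sx] [_ sy]; apply: finj; rewrite inE /disc /=; exact: sh_rho.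
- move=> y [my sy]; have [x ax fx] := fsurj y (sh_rho _ _ sy); exists x => //.
  by split; [apply/fmark; rewrite ?fx | move: sy; rewrite /shell /= -fx fdist].
Qed.

(** At distance [4 * rho] from a root one is still far from all other roots. *)
Lemma layer_free_net :
  exists k, net k (free F (Layer A all_marks rho marker_width (2 ^ (2 * q)))).
Proof.
have [we wk] := width_ge; have re := rho_ge; have w0 := width_gt0.
exists (9 * rho) => x.
have [x' [xx' far]] : exists x', dist x x' <= 8 * rho /\
    forall a, A a -> 4 * rho <= dist x' a.
  have [[a Aa xa]|none] := pselect (exists2 a, A a & dist x a <= 4 * rho); last first.
    exists x; rewrite dist_refl; split=> // a Aa; rewrite leqNgt; apply/negP => lt.
    by apply: none; exists a => //; exact: ltnW.
  have [x' ax'] := sphere_neq0 Xinfinite a (4 * rho).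
  exists x'; split; first by have := dist_triangle a x x'; lia.
  move=> a' Aa'; have [->|aa'] := pselect (a' = a); first by rewrite dist_sym ax'.
  have := sepA Aa' Aa aa'; have := dist_triangle x' a' a.
  by rewrite (dist_sym a' x') (dist_sym x' a) ax'; lia.
have [y Fy x'y] := netF x'; exists y; last by have := dist_triangle x' x y; lia.
split=> // a /= Aa; have := far a Aa; have := dist_triangle y x' a.
by rewrite (dist_sym a y); lia.
Qed.

(** If the disc of radius [34 * rho] about [x] is too large for the labels of
    [capacity_small], cover it in 35 steps by discs of radius [rho - hole]: a disc
    of this radius must have at least [2 ^ (2 * q)] vertices. It is contained in the disc
    of radius [rho] about a free vertex, which is close to a rich root. *)
Lemma layer_cover x : (exists2 a, A a & dist x a <= 11 * rho) \/
  (exists a, [/\ A a, rich_disc a & dist x a <= 46 * rho]).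
Proof.
have [we wk] := width_ge; have re := rho_ge; have w0 := width_gt0.
have [small|large] := leqP (setcard (disc x (34 * rho))) (2 ^ (70 * q)).
  left; have [y Fy xy] := netF x; have [|a Aa ya] := A_small Fy.
    apply: leq_trans small; apply: setcard_le; first exact: disc_finite.
    by move=> z; rewrite /disc /= => yz; have := dist_triangle y x z; lia.
  by exists a => //; have := dist_triangle y x a; lia.
right; have [u [xu ubig]] : exists u, dist x u <= 35 * (rho - hole) /\
    2 ^ (2 * q) <= setcard (disc u (rho - hole)).
  apply: contrapT => none; move: large; rewrite ltnNge => /negP; apply.
  apply: (@leq_trans (setcard (disc x (35 * (rho - hole))))).
    apply: setcard_le; first exact: disc_finite.
    by move=> z; rewrite /disc /=; lia.
  have -> : 2 ^ (70 * q) = (2 ^ (2 * q)) ^ 35 by rewrite -expnM; congr (_ ^ _); lia.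
  apply: (setcard_disc_muln degD) => u xu; rewrite leqNgt; apply/negP => lt.
  by apply: none; exists u; split=> //; exact: ltnW.
have [y Fy uy] := netF u; have [|a [Aa ba ya]] := A_rich Fy.
  apply: leq_trans ubig _; apply: setcard_le; first exact: disc_finite.
  move=> z; rewrite /disc /= => uz; have := dist_triangle u y z.
  by rewrite (dist_sym y u); lia.
exists a; split=> //; have := dist_triangle u x a; have := dist_triangle y u a.
by lia.
Qed.

Lemma layer_specP :
  layer_spec F prev_gap rmin base (Layer A all_marks rho marker_width (2 ^ (2 * q))).
Proof.
have [we wk] := width_ge; have re := rho_ge; have w0 := width_gt0; have ee := marker_width_ge.
have dl := partner_dist_bounds.
split=> /=.
- by lia.
- by have := rho_gt_q; lia.
- exact: root_mark.
- move=> z [a Aa [[->|->|->]|[k /(proj1 (sP k Aa))[Pz _]]]].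
  + by exists a; [exact: AF | rewrite dist_refl].
  + by exists a; [exact: AF | rewrite dist_sym; have [_ -> _ _] := bcP a; lia].
  + by exists (c a); [have [] := bcP a | rewrite dist_refl].
  + by exists z; [exact: PF | rewrite dist_refl].
- by move=> z [a Aa /(mark_of_dist Aa)/ltnW]; exists a.
- move=> x y z mx my mz xy yz xz dxy dyz; rewrite ltnNge; apply/negP => dxz.
  have [|a [Aa tx ty]] := all_marks_close mx my xy; first by lia.
  have [|a' [Aa' ty' tz]] := all_marks_close my mz yz; first by lia.
  have eaa := triple_eq Aa Aa' ty ty'; rewrite -eaa in tz.
  have [|[ex ey]|[ex ey]] := triple_pair tx ty xy; first by lia.
    have [|[ey' ez]|[ey' ez]] := triple_pair ty tz yz; first by lia.
      by apply: xy; rewrite ex ey'.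
    by apply: xz; rewrite ex ez.
  have [|[ey' ez]|[ey' ez]] := triple_pair ty tz yz; first by lia.
    by apply: xz; rewrite ex ez.
  by apply: xy; rewrite ex ey'.
- move=> a Aa; have [_ ab abc /andP[ac ace]] := bcP a.
  exists (b a), (c a); split.
  + by exists a => //; left; constructor 2.
  + by exists a => //; left; constructor 3.
  + split=> h; first by move: ab; rewrite h dist_refl; lia.
    by move: ac; rewrite h ab; lia.
  + by lia.
  + by rewrite ab.
- move=> z mz [b' [c' [mb' mc' [bz cb] zb [zc zce]]]].
  have zb0 : dist z b' <> 0 by move=> /dist_eq0/esym.
  have zc0 : z <> c' by move=> h; move: zc; rewrite -h dist_refl; lia.
  have [||a [Aa tz tb]] := all_marks_close mz mb'; [by move=> /esym | by lia |].
  have [||a' [Aa' tz' tc]] := all_marks_close mz mc'; [by [] | by lia |].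
  have eaa := triple_eq Aa Aa' tz tz'; rewrite -eaa in tc.
  have [||[ez eb]|[ez eb]] := triple_pair tz tb; [by move=> /esym | by lia | by rewrite ez |].
  have [_ ab abc _] := bcP a.
  case: tc zc => [h|h|->]; [by case: cb; rewrite eb h | by case: zc0; rewrite ez h |].
  by rewrite ez eb (dist_sym (b a) a) ab; lia.
- move=> x y mx my xy dxy; have [|a [Aa tx ty]] := all_marks_close mx my xy; first by lia.
  have [_ ab _ _] := bcP a.
  have bd : partner_dist <= 2 -> base by rewrite /partner_dist; case: base.
  have [|[ex ey]|[ex ey]] := triple_pair tx ty xy; first by lia.
    by split; [apply: bd; move: dxy; rewrite ex ey ab | left; rewrite ex].
  by split; [apply: bd; move: dxy; rewrite ex ey dist_sym ab | right; rewrite ey].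
- move=> bs a Aa; exists (b a); first by exists a => //; left; constructor 2.
  by apply: adj_dist; have [_ -> _ _] := bcP a; rewrite /partner_dist bs.
- exact: layer_cover.
- move=> a a' Aa Aa' aa' /(mark_iso_label Aa Aa')[eb el].
  have := lab_neq Aa Aa' aa'; rewrite /conflict /conflict_range el eb => h.
  have {}h : ~ (dist a a' <= (if rich_disc a' then 138 * rho else 33 * rho)).
    by move=> h'; case: h.
  rewrite -[rich _ a]/(rich_disc a) eb.
  by case: (rich_disc a') h => /negP; rewrite -ltnNge => h; split=> //; lia.
- exact: layer_free_net.
Qed.

End LayerConstruction.

(** Rich roots are chosen first, as they must be close to all vertices where the
    graph grows fast; the other roots are then added where there is room. *)
Lemma layer_exists (X : graph) (D : nat) (F : set X) (hole prev_gap rmin : nat)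
    (base : bool) :
  infinite_set [set: X] -> countable [set: X] -> (forall x : X, degree x <= D) ->
  net hole F -> exists l, layer_spec F prev_gap rmin base l.
Proof.
move=> Xinf Xcount degD netF; pose near := marker_width hole prev_gap.
have tex a := cid (@triple_exists X Xinf F hole prev_gap base netF a).
pose b a := (sval (tex a)).1; pose c a := (sval (tex a)).2.
have bcP a : [/\ F (c a), dist a (b a) = partner_dist base,
    dist a (c a) = partner_dist base + dist (b a) (c a) &
    prev_gap + 8 <= dist a (c a) <= near].
  exact: svalP (tex a).
have sep0 d : separated d (set0 : set X) by [].
have [P [_ PF sepP covP]] := max_separated F (sep0 near).
rewrite set0U in PF.
have netP : net (hole + near) P.
  move=> x; have [y Fy xy] := netF x; have [z Pz yz] := covP y Fy.
  by exists z => //; have := dist_triangle y x z; lia.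
have [q [q_rmin q_gt0 q_big]] :=
  exp_beats_linear (71 * width hole prev_gap * loss D hole prev_gap) rmin.
pose R := rho hole prev_gap q; pose rich_disc (a : X) := 2 ^ (2 * q) <= setcard (disc a R).
have [A1 [_ A1F sep1 cov1]] :=
  max_separated [set x | F x /\ rich_disc x] (sep0 (10 * R)).
have [A [A1A AF sepA covA]] := max_separated
  [set x | F x /\ setcard (disc x (33 * R)) <= 2 ^ (70 * q)] sep1.
rewrite set0U in A1F.
have {}AF a : A a -> F a /\ (rich_disc a \/ setcard (disc a (33 * R)) <= 2 ^ (70 * q)).
  by move=> /AF[/A1F[Fa ba]|[Fa sa]]; split=> //; [left|right].
have A_kinds a : A a -> rich_disc a \/ setcard (disc a (33 * R)) <= 2 ^ (70 * q).
  by case/AF.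
pose lst := @labels X D hole prev_gap P q.
have [||lab [lab_in lab_neq]] := @list_coloring X _ [ffun=> ord0] A
    (@conflict X hole prev_gap q) lst Xcount.
- exact: conflict_sym.
- move=> a Aa; rewrite (card_labels degD).
  exact: (few_conflicts Xinf degD netP q_rmin q_gt0 q_big A_kinds Aa).
have sex (a : X) (k : 'I_(depth q)) : {S | A a ->
    S `<=` slots hole prev_gap P a k /\ setcard S = lab a k}.
  have [Aa|nAa] := pselect (A a); last by exists set0.
  apply: cid; have := lab_in a Aa; rewrite inE => /forallP/(_ k) lk.
  have [|S SP cS] := setcard_subset (n := lab a k) (slots_finite hole prev_gap P a k).
    by move: lk; rewrite /capacity; case: ifP => _; rewrite ltnS // => /leq_trans->.
  by exists S.
pose s a k := sval (sex a k).
exists (Layer A (@all_marks X b c q A s) R near (2 ^ (2 * q))).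
apply: (layer_specP Xinf degD netF bcP sepP PF q_rmin q_gt0 q_big _ sepA _ _
  lab_in lab_neq).
- by move=> a /AF[].
- by move=> x Fx bx; have [a Aa xa] := cov1 x (conj Fx bx);
    exists a; split=> //; [exact: A1A | case: (A1F a Aa)].
- by move=> x Fx sx; exact: covA.
- by move=> a k Aa; exact: svalP (sex a k) Aa.
Qed.

(** * Predicates determined by colored discs *)

(** Isomorphisms of large colored discs preserve such predicates, so these play
    the role of the predicates that pass to the limits of the colored graph. *)
Definition local_pred (X : graph) (n : nat) (phi : X -> 'I_n) (Q : set X) :=
  exists C, forall x y, same_col_disc phi phi x y C -> Q x -> Q y.

Section LocalPred.
Variables (X : graph) (n : nat) (phi : X -> 'I_n).
Implicit Types Q : set X.

Lemma local_predP Q : local_pred phi Q -> exists C, forall x y s f, C <= s ->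
  disc_iso x y s f -> (forall u, dist x u <= s -> phi (f u) = phi u :> nat) ->
  forall u, dist x u + C <= s -> (Q u <-> Q (f u)).
Proof.
move=> [C QC]; exists C => x y s f Cs If fc u us.
have h := same_col_disc_shift If fc us.
by split; apply: QC => //; exact: same_col_disc_sym.
Qed.

Lemma local_predI Q1 Q2 : local_pred phi Q1 -> local_pred phi Q2 ->
  local_pred phi (Q1 `&` Q2).
Proof.
move=> [C1 h1] [C2 h2]; exists (maxn C1 C2) => x y xy [q1 q2]; split.
  by apply: h1 q1; apply: same_col_disc_le xy; exact: leq_maxl.
by apply: h2 q2; apply: same_col_disc_le xy; exact: leq_maxr.
Qed.

Lemma local_predC Q : local_pred phi Q -> local_pred phi (~` Q).
Proof.
move=> [C h]; exists C => x y xy nQ Qy; apply: nQ; apply: h Qy.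
exact: same_col_disc_sym.
Qed.

Lemma local_pred_ext Q1 Q2 : (forall x, Q1 x <-> Q2 x) -> local_pred phi Q1 ->
  local_pred phi Q2.
Proof. by move=> e [C h]; exists C => x y xy /e q; apply/e; exact: h q. Qed.

Definition within (S : set X) (t : nat) : set X :=
  [set x | exists2 a, S a & dist x a <= t].

Lemma local_within Q t : local_pred phi Q -> local_pred phi (within Q t).
Proof.
move=> /local_predP[C h]; exists (t + C) => x y /same_col_discP[f If fc] [a Qa xa].
exists (f a); first by apply: (iffLR (h _ _ _ _ _ If fc _ _)) => //; lia.
by rewrite -(disc_iso_center If) (disc_iso_dist If) ?dist_refl //; lia.
Qed.

Lemma local_marked Q e : local_pred phi Q -> local_pred phi (marked e Q).
Proof.
move=> /local_predP[C h]; exists (2 * e + C) => x y /same_col_discP[f If fc].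
move=> [b [c [Qb Qc [bx cb] xb [xc xce]]]].
have fx := disc_iso_center If.
have fd u v : dist x u + dist u v <= 2 * e + C -> dist (f u) (f v) = dist u v.
  exact: (disc_iso_dist If).
have xx := dist_refl x.
exists (f b), (f c); rewrite -fx; split.
- by apply: (iffLR (h _ _ _ _ _ If fc _ _)) => //; lia.
- by apply: (iffLR (h _ _ _ _ _ If fc _ _)) => //; lia.
- by split=> /(disc_iso_inj If) h'; [apply: bx; apply: h'; lia | apply: cb; apply: h'; lia].
- by rewrite fd; lia.
- by rewrite !fd; lia.
Qed.

Lemma local_disc_card r k : local_pred phi [set x | k <= setcard (disc x r)].
Proof.
exists r => x y /same_col_discP[f If fc] /=.
by case: If => fbij _ _; rewrite (setcard_bij _ fbij) //; exact: disc_finite.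
Qed.

End LocalPred.

(** * The tower of layers *)

Lemma layer_tower (X : graph) (D : nat) :
  infinite_set [set: X] -> countable [set: X] -> (forall x : X, degree x <= D) ->
  exists (F : nat -> set X) (l : nat -> layer X),
    (forall n, F n.+1 = free (F n) (l n)) /\
    forall n, layer_spec (F n) (if n is m.+1 then gap (l m) else 0) n (n == 0) (l n).
Proof.
move=> Xinf Xcount degD.
have ex F prev_gap rmin base : {l : layer X | (exists k, net k F) ->
    layer_spec F prev_gap rmin base l}.
  apply: cid; have [[k netF]|nF] := pselect (exists k, net k F).
    by have [l ls] := layer_exists prev_gap rmin base Xinf Xcount degD netF; exists l.
  by exists (Layer set0 set0 0 0 0).
pose pick F prev_gap rmin base := sval (ex F prev_gap rmin base).
have pickP F prev_gap rmin base : (exists k, net k F) ->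
    layer_spec F prev_gap rmin base (pick F prev_gap rmin base).
  exact: svalP (ex F prev_gap rmin base).
pose st := fix st n : set X * layer X := if n is m.+1 then
    let F := free (st m).1 (st m).2 in (F, pick F (gap (st m).2) m.+1 false)
  else (setT, pick setT 0 0 true).
have net_st n : exists k, net k (st n).1.
  elim: n => [|n IHn]; first by exists 0 => x; exists x; rewrite // dist_refl.
  have spec_n : exists prev_gap rmin base, layer_spec (st n).1 prev_gap rmin base (st n).2.
    by case: n IHn => [|n] IHn; do 3 eexists; exact: pickP.
  by have [prev_gap [rmin [base /ls_free]]] := spec_n.
exists (fun n => (st n).1), (fun n => (st n).2); split=> // n.
by case: n (net_st n) => [|n] h; exact: pickP.
Qed.

Section Assembly.
Variable X : graph.
Variables (x0 : X) (D' : nat).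
Hypothesis degD : forall x : X, degree x <= D'.+1.
Variables (F : nat -> set X) (l : nat -> layer X).
Hypothesis F_next : forall n, F n.+1 = free (F n) (l n).
Hypothesis l_spec : forall n,
  layer_spec (F n) (if n is m.+1 then gap (l m) else 0) n (n == 0) (l n).

Definition marks_from (n : nat) : set X := [set z | exists2 m, n <= m & marks (l m) z].
Let Z := marks_from 0.
Let A n := roots (l n).

Lemma radius_ge n : gap (l n) + 10 <= radius (l n) /\ n <= radius (l n).
Proof. exact: ls_radius (l_spec n). Qed.

Lemma gap_mono n m : n <= m -> gap (l n) <= gap (l m).
Proof.
move=> /subnK <-; elim: (m - n) => // k IHk; apply: leq_trans IHk _.
exact: (ls_gap (l_spec (k + n).+1)).
Qed.

Lemma F_mono n m : n <= m -> F m `<=` F n.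
Proof.
move=> /subnK <-; elim: (m - n) => // k IHk x.
by rewrite addSn F_next => -[/IHk].
Qed.

(** Marks of later layers are within distance three of the vertices that layer
    [n] has left free. *)
Lemma marks_far n m a z : n < m -> A n a -> marks (l m) z ->
  2 * radius (l n) < dist a z + 3.
Proof.
move=> nm Aa mz; have [y Fy zy] := ls_marksF (l_spec m) mz.
have := F_mono nm Fy; rewrite F_next => -[_ /(_ a Aa)].
by have := dist_triangle z a y; lia.
Qed.

Lemma marks_apart n m z z' : n < m -> marks (l n) z -> marks (l m) z' ->
  gap (l n) + 7 < dist z z'.
Proof.
move=> nm mz mz'; have [a Aa az] := ls_marks_near (l_spec n) mz.
have := marks_far nm Aa mz'; have := dist_triangle z a z'.
by have [] := radius_ge n; lia.
Qed.

Lemma same_layer k n m z z' : marks (l n) z -> marks (l m) z' ->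
  k <= n -> k <= m -> dist z z' <= gap (l k) + 7 -> n = m.
Proof.
move=> mz mz' kn km dz; have gn := gap_mono kn; have gm := gap_mono km.
case: (ltngtP n m) => // nm; first by have := marks_apart nm mz mz'; lia.
by have := marks_apart nm mz' mz; rewrite (dist_sym z' z); lia.
Qed.

(** Only the roots of layer [n] carry the marker of that layer within the marks
    of the layers from [n] on, since all later markers are wider. *)
Lemma roots_marked n z : A n z <-> marks_from n z /\ marked (gap (l n)) (marks_from n) z.
Proof.
have sub : marks (l n) `<=` marks_from n by move=> x; exists n.
split=> [Az|[[m nm mz] [b [c [[j nj mb] [k nk mc] [bz cb] zb [zc zce]]]]]].
  split; first by apply: sub; exact: (ls_roots_marks (l_spec n) Az).
  have [b [c [mb mc h1 h2 h3]]] := ls_marked (l_spec n) Az.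
  by exists b, c; split=> //; exact: sub.
have ejm : j = m by apply/esym; apply: (same_layer mz mb nm nj); lia.
have ekm : k = m by apply/esym; apply: (same_layer mz mc nm nk); lia.
rewrite {j nj}ejm in mb; rewrite {k nk}ekm in mc.
have zb0 : dist z b <> 0 by move=> /dist_eq0/esym.
have zc0 : z <> c by move=> h; move: zc; rewrite -h dist_refl; lia.
move: nm; rewrite leq_eqVlt => /orP[/eqP nm|].
  by rewrite -nm in mz mb mc; apply: (ls_markedK (l_spec n) mz); exists b, c.
case: m mz mb mc => // m mz mb mc; rewrite ltnS => /gap_mono gm.
have := ls_no3 (l_spec m.+1) mz mb mc; rewrite ltnNge => h.
by exfalso; apply: (negP (h _ _ _ _ _)) => //; [move=> /esym | move=> /esym | lia..].
Qed.

(** Once the roots of layer [n] are known, its marks are also known, since the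
    later layers avoid the discs around these roots. *)
Lemma marks_near_root n z : marks (l n) z <->
  marks_from n z /\ within (A n) (radius (l n)) z.
Proof.
split=> [mz|[[m nm mz] [a Aa za]]].
  split; first by exists n.
  by have [a Aa az] := ls_marks_near (l_spec n) mz; exists a; rewrite // dist_sym.
move: nm; rewrite leq_eqVlt => /orP[/eqP->//|nm].
by have := marks_far nm Aa mz; rewrite dist_sym; have [] := radius_ge n; lia.
Qed.

Lemma marks_fromS n z : marks_from n.+1 z <-> marks_from n z /\ ~ marks (l n) z.
Proof.
split=> [[m nm mz]|[[m nm mz] nz]].
  split; first by exists m => //; exact: ltnW.
  by move=> mz'; have := marks_apart nm mz' mz; rewrite dist_refl.
by exists m => //; rewrite ltn_neqAle nm andbT; apply/eqP => enm; apply: nz; rewrite enm.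
Qed.

Lemma marks_close x y : Z x -> Z y -> x <> y -> dist x y <= 2 -> A 0 x \/ A 0 y.
Proof.
move=> [n n0 mx] [m m0 my] xy d2; have enm : n = m by apply: (same_layer mx my n0 m0); lia.
rewrite -enm in my; have [/eqP n0' h] := ls_close (l_spec n) mx my xy d2.
by rewrite /A -n0'.
Qed.

(** ** The coloring *)

Let r1 := 11 * radius (l 0).
Let r2 := 46 * radius (l 0).
Let Arich : set X := [set a | A 0 a /\ rich (l 0) a].

(** Every vertex which is not [inner] has a rich root at distance at most [r2]; this
    is the range in which labels distinguish rich roots, but not all the roots.
    So the parents of [inner] vertices are chosen with respect to all roots, and
    the parents of the other ones with respect to the rich roots only. *)
Definition inner : set X := within (A 0) r1.

(** Comparison of the distances to [S], also meaningful if [S] is empty. *)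
Definition closer (S : set X) (y x : X) : Prop := exists t, within S t y /\ ~ within S t x.
Definition down (S : set X) (x : X) : set X := [set y | adj x y /\ closer S y x].

Lemma within_le (S : set X) s t : s <= t -> within S s `<=` within S t.
Proof. by move=> st x [a Sa xa]; exists a => //; exact: leq_trans st. Qed.

Lemma within0 (S : set X) x : within S 0 x -> S x.
Proof. by move=> [a Sa]; rewrite leqn0 => /eqP/dist_eq0->. Qed.

Lemma within_self (S : set X) t x : S x -> within S t x.
Proof. by move=> Sx; exists x; rewrite // dist_refl. Qed.

Lemma closer_within (S : set X) t y x : closer S y x -> within S t.+1 x -> within S t y.
Proof.
move=> [s [ys xs]] xt; apply: (within_le _ ys); rewrite -ltnS ltnNge; apply/negP => ts.
exact: xs (within_le ts xt).
Qed.

Lemma closer_asym (S : set X) x y : closer S x y -> ~ closer S y x.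
Proof.
move=> [s [xs ys]] [t [yt xt]]; have [st|ts] := leqP s t.
  exact: xt (within_le st xs).
exact: ys (within_le (ltnW ts) yt).
Qed.

Lemma within_down (S : set X) t x : within S t.+1 x -> ~ within S t x ->
  exists2 y, adj x y & within S t y.
Proof.
move=> [a Sa xa] nx; have xat : dist x a = t.+1.
  apply/eqP; rewrite eqn_leq xa /= ltnNge; apply/negP => xt.
  by apply: nx; exists a.
by have [y xy ya] := dist_pred xat; exists y => //; exists a; rewrite ?ya.
Qed.

Lemma down_neq0 (S : set X) t x : within S t x -> ~ S x -> exists y, down S x y.
Proof.
elim: t => [/within0//|t IHt] xt nSx.
have [xt'|nxt] := pselect (within S t x); first exact: IHt.
by have [y xy yt] := within_down xt nxt; exists y; split=> //; exists t.
Qed.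

(** The choice depends on the set of candidates only, hence vertices with the same
    candidates are siblings. *)
Definition parent (x : X) : X :=
  xget x0 (if `[< inner x >] then down (A 0) x else down Arich x).

Lemma parent_inner x : inner x -> ~ A 0 x -> down (A 0) x (parent x).
Proof.
move=> ix nAx; rewrite /parent asboolT //; have [y yd] := down_neq0 ix nAx.
exact: (xgetI _ yd).
Qed.

Lemma parent_outer x : ~ inner x -> down Arich x (parent x).
Proof.
move=> nix; rewrite /parent asboolF //.
have [ix|[a [Aa ba xa]]] := ls_cover (l_spec 0) x; first by case: nix.
have [||y yd] := @down_neq0 Arich r2 x; first by exists a.
  by move=> [Ax _]; apply: nix; exact: within_self.
exact: (xgetI _ yd).
Qed.

Lemma parent_adj x : ~ A 0 x -> adj x (parent x).
Proof.
move=> nAx; have [ix|nix] := pselect (inner x).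
  by have [] := parent_inner ix nAx.
by have [] := parent_outer nix.
Qed.

Lemma closer_inner x y : inner x -> closer (A 0) y x -> inner y.
Proof.
move=> ix [t [yt nxt]]; apply: (within_le _ yt); rewrite leqNgt; apply/negP => rt;
   apply: nxt; exact: within_le (ltnW rt) _ ix.
Qed.

(** For two [inner] vertices, or two vertices that are not [inner], this is because
    parents are closer; and parents of [inner] vertices are [inner]. *)
Lemma parent_parent x : ~ A 0 x -> ~ A 0 (parent x) -> parent (parent x) <> x.
Proof.
move=> nAx nAp ppx; set y := parent x in nAp ppx.
have [ix|nix] := pselect (inner x).
  have [_ yx] := parent_inner ix nAx; have iy := closer_inner ix yx.
  have [_] := parent_inner iy nAp; rewrite ppx; exact: closer_asym yx.
have [_ yx] := parent_outer nix; have [iy|niy] := pselect (inner y).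
  by have [_] := parent_inner iy nAp; rewrite ppx => /(closer_inner iy).
by have [_] := parent_outer niy; rewrite ppx; exact: closer_asym yx.
Qed.

Definition children (u : X) : set X := [set v | [/\ ~ Z v, adj u v & parent v = u]].

Lemma roots_Z x : A 0 x -> Z x.
Proof. by move=> Ax; exists 0 => //; exact: (ls_roots_marks (l_spec 0)). Qed.

Lemma children_finite u : finite_set (children u).
Proof. by apply: sub_finite_set (adj_fin u) => v []. Qed.

(** A root has a neighbor that is a mark, and any other vertex has its parent,
    so one neighbor at least is not to be counted. *)
Lemma card_children u : setcard (children u) <= D'.
Proof.
have [y uy ny] : exists2 y, adj u y & ~ children u y.
  have [Au|nAu] := pselect (A 0 u).
    have [y my uy] := ls_partner (l_spec 0) isT Au.
    by exists y => // -[+ _ _]; apply; exists 0.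
  exists (parent u); first exact: parent_adj.
  move=> [nZ _]; apply: parent_parent => // Ap; apply: nZ; exact: roots_Z.
rewrite -ltnS; apply: leq_trans (degD u); rewrite /degree.
apply: leq_ltn_trans (setcardD1_lt (adj_fin u) uy).
apply: setcard_le; first by apply: finite_setD; exact: adj_fin.
by move=> v cv; split; [case: cv | move=> vy; apply: ny; rewrite -vy].
Qed.

Definition color_index (v : X) : nat :=
  if `[< Z v >] then 0 else (index v (enum_fset (fset_set (children (parent v))))).+1.

Lemma color_index_lt v : color_index v < D'.+1.
Proof.
rewrite ltnS /color_index; case: asboolP => // nZ.
have nA : ~ A 0 v by move=> /roots_Z.
apply: leq_trans (card_children (parent v)); rewrite /setcard index_mem.
rewrite in_fset_set; last exact: children_finite.
by rewrite inE; split=> //; rewrite adj_sym; exact: parent_adj.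
Qed.

Lemma color_index_eq0 v : color_index v = 0 <-> Z v.
Proof. by rewrite /color_index; case: asboolP. Qed.

(** Two marks at distance at most two include a root, so siblings cannot both be
    marks. *)
Lemma siblings_colors v w : ~ A 0 v -> ~ A 0 w -> parent v = parent w ->
  color_index v = color_index w -> v = w.
Proof.
move=> nAv nAw pvw cvw; apply: contrapT => vw.
have d2 : dist v w <= 2.
  have := dist_triangle (parent v) v w; have := dist_adj (parent_adj nAv).
  by have := dist_adj (parent_adj nAw); rewrite -pvw (dist_sym w); lia.
have [Zv|nZv] := pselect (Z v).
  have Zw : Z w by apply/color_index_eq0; rewrite -cvw; apply/color_index_eq0.
  by case: (marks_close Zv Zw vw d2).
have nZw : ~ Z w by move=> /color_index_eq0; rewrite -cvw => /color_index_eq0.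
move: cvw; rewrite /color_index !asboolF // -pvw => -[ivw].
apply: vw.
have mem x : ~ Z x -> ~ A 0 x -> parent x = parent v ->
    x \in enum_fset (fset_set (children (parent v))).
  move=> nZ nA px; rewrite in_fset_set; last exact: children_finite.
  by rewrite inE; split=> //; rewrite adj_sym -px; exact: parent_adj.
by rewrite -(nth_index v (mem v nZv nAv erefl)) ivw (nth_index v (mem w nZw nAw _)).
Qed.

Variable phi : X -> 'I_D'.+1.
Hypothesis phiE : forall v, phi v = color_index v :> nat.

(** ** Locality of the layers *)

(** The marks are the vertices of color [0]. Inductively, the marks of the layers
    from [n] on determine the roots of layer [n], these determine its marks, and
    the marks of the layers from [n + 1] on are the remaining ones. *)
Lemma local_marks_from n : local_pred phi (marks_from n) /\
  local_pred phi (A n) /\ local_pred phi (marks (l n)).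
Proof.
have step m : local_pred phi (marks_from m) ->
    local_pred phi (A m) /\ local_pred phi (marks (l m)).
  move=> lm; have lA : local_pred phi (A m).
    apply: local_pred_ext (local_predI lm (local_marked (gap (l m)) lm)).
    by move=> z; rewrite roots_marked.
  split=> //; apply: local_pred_ext (local_predI lm (local_within (radius (l m)) lA)).
  by move=> z; rewrite marks_near_root.
suff lm : local_pred phi (marks_from n) by split=> //; exact: step.
elim: n => [|n IHn].
  exists 0 => x y /same_col_discP[f If fc] /color_index_eq0 Zx; apply/color_index_eq0.
  by rewrite -Zx -(disc_iso_center If) -!phiE fc ?dist_refl.
have [_ lZ] := step n IHn.
apply: local_pred_ext (local_predI IHn (local_predC lZ)) => z.
by rewrite marks_fromS.
Qed.

Lemma local_inner : local_pred phi inner.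
Proof. by apply: local_within; have [_ []] := local_marks_from 0. Qed.

Lemma local_Arich : local_pred phi Arich.
Proof.
have [_ [lA _]] := local_marks_from 0.
by apply: local_pred_ext (local_predI lA (local_disc_card phi (radius (l 0))
  (threshold (l 0)))).
Qed.

(** A colored isomorphism between large discs about roots of layer [n] matches
    the marks of this layer, so it cannot move a root by a moderate distance. *)
Lemma roots_rigid n : exists C, forall a a', A n a ->
  same_col_disc phi phi a a' C -> a <> a' ->
  33 * radius (l n) < dist a a' /\ (rich (l n) a -> 138 * radius (l n) < dist a a').
Proof.
have [_ [[C1 lA] /local_predP[C2 lZ]]] := local_marks_from n.
exists (maxn C1 (radius (l n) + C2)) => a a' Aa aa' neq.
have Aa' : A n a' by apply: lA Aa; apply: same_col_disc_le aa'; exact: leq_maxl.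
apply: (ls_distinct (l_spec n)) => //.
have /same_col_discP[f If fc] := same_col_disc_le (leq_maxr _ _) aa'.
exists f; split.
- have := disc_iso_shift If (u := a) (s := radius (l n)).
  by rewrite (disc_iso_center If) dist_refl add0n => /(_ (leq_addr _ _))[].
- move=> u au; rewrite -(disc_iso_center If) (disc_iso_dist If) ?dist_refl //; lia.
- by move=> u au; apply: iff_sym; apply: (lZ _ _ _ _ _ If fc); lia.
Qed.

(** ** Rigidity *)

Lemma down_within (S : set X) t x : within S t.+1 x -> ~ within S t x ->
  down S x = [set y | adj x y /\ within S t y].
Proof.
move=> xt nxt; apply/seteqP; split=> y [xy h]; split=> //.
  exact: closer_within h xt.
by exists t.
Qed.

(** If the vertices at distance at most [t] from [S] cannot be moved a little,
    then a vertex at distance [t + 1] keeps the same set of neighbors closer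
    to [S]. *)
Lemma down_rigid (S : set X) t d C : local_pred phi S ->
  (forall y y', within S t y -> same_col_disc phi phi y y' C -> dist y y' <= d + 2 ->
     y = y') ->
  exists C', forall v v', within S t.+1 v -> ~ within S t v ->
    same_col_disc phi phi v v' C' -> dist v v' <= d -> down S v = down S v'.
Proof.
move=> lS IH; have [C1 l1] := local_within t.+1 lS; have [C2 l2] := local_within t lS.
pose C3 := maxn C (maxn C1 C2); exists C3.+1 => v v' vt nvt vv' dvv'.
have CC : C <= C3 by rewrite leq_maxl.
have CC1 : C1 <= C3 by rewrite /C3; lia.
have CC2 : C2 <= C3 by rewrite /C3; lia.
have v't : within S t.+1 v'.
  by apply: l1 vt; apply: same_col_disc_le vv'; exact: leqW.
have nv't : ~ within S t v'.
  move=> h; apply: nvt; apply: l2 h; apply: same_col_disc_sym.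
  by apply: same_col_disc_le vv'; exact: leqW.
rewrite (down_within vt nvt) (down_within v't nv't).
have /same_col_discP[f If fc] := vv'; have fv := disc_iso_center If.
have nb y : adj v y -> [/\ adj v' (f y), same_col_disc phi phi y (f y) C3 &
    dist y (f y) <= d + 2].
  move=> vy; have vy1 := dist_adj vy; have ad : adj v' (f y).
    by rewrite -fv (disc_iso_adj If) ?dist_refl //; lia.
  split=> //; first by apply: (same_col_disc_shift If fc); lia.
  have := dist_triangle v y (f y); have := dist_triangle v' v (f y).
  by have := dist_adj ad; rewrite (dist_sym y v); lia.
apply/seteqP; split=> y [vy yt].
  have [ad iso dy] := nb y vy; suff -> : y = f y.
    by split=> //; apply: l2 yt; exact: same_col_disc_le iso.
  by apply: IH => //; exact: same_col_disc_le iso.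
have [|u vu fu] := disc_iso_surj If (v := y); first by have := dist_adj vy; lia.
have vu1 : adj v u by rewrite -(disc_iso_adj If) ?fv ?fu ?dist_refl.
have [ad iso dy] := nb u vu1; rewrite fu in iso dy.
have ut : within S t u.
  by apply: l2 yt; apply: same_col_disc_sym; exact: same_col_disc_le iso.
suff <- : u = y by [].
by apply: IH => //; exact: same_col_disc_le iso.
Qed.

(** Having the same candidates for a parent, [v] and [v'] are siblings. *)
Lemma siblings_rigid v v' : ~ A 0 v -> ~ A 0 v' -> (inner v <-> inner v') ->
  (inner v -> down (A 0) v = down (A 0) v') ->
  (~ inner v -> down Arich v = down Arich v') ->
  phi v = phi v' :> nat -> v = v'.
Proof.
move=> nAv nAv' ivv' dA dB; rewrite !phiE => cvv'.
apply: siblings_colors => //; rewrite /parent.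
have [iv|niv] := pselect (inner v).
  by rewrite (asboolT iv) (asboolT (iffLR ivv' iv)) dA.
have niv' : ~ inner v' by move=> /ivv'.
by rewrite (asboolF niv) (asboolF niv') dB.
Qed.

(** Induction on the distance [t] to the roots. The bound on the displacement
    increases by two when passing to a neighbor closer to the roots; at the roots
    it is still below the range of the labels. *)
Lemma inner_rigid t : t <= r1 -> exists C, forall v v', within (A 0) t v ->
  same_col_disc phi phi v v' C -> dist v v' <= 2 + 2 * (r1 - t) -> v = v'.
Proof.
have [_ rad] := radius_ge 0; have [rad1 _] := radius_ge 0.
have [_ [lA _]] := local_marks_from 0.
elim: t => [_|t IHt tr].
  have [C h] := roots_rigid 0; exists C => v v' /within0 Av vv' dvv'.
  apply: contrapT => neq; have [+ _] := h v v' Av vv' neq.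
  by move: dvv'; rewrite /r1; lia.
have [C1 IH] := IHt (ltnW tr).
have [|C2 dr] := @down_rigid (A 0) t (2 + 2 * (r1 - t.+1)) C1 lA.
  by move=> y y' yt yy' dyy'; apply: IH => //; lia.
have [C3 li] := local_inner; have [C4 lA'] := lA.
pose C := C1 + C2 + C3 + C4; exists C => v v' vt vv' dvv'.
have iso k : k <= C -> same_col_disc phi phi v v' k.
  by move=> kC; exact: same_col_disc_le vv'.
have [vt'|nvt] := pselect (within (A 0) t v).
  by apply: IH => //; [apply: iso; rewrite /C; lia | lia].
have iv : inner v by exact: within_le vt.
have iv' : inner v' by apply: li iv; apply: iso; rewrite /C; lia.
have nAv : ~ A 0 v by move=> Av; apply: nvt; exact: within_self.
have nAv' : ~ A 0 v'.
  move=> Av'; apply: nAv; apply: lA' Av'; apply: same_col_disc_sym; apply: iso.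
  by rewrite /C; lia.
apply: siblings_rigid => // [_|].
  by apply: dr => //; apply: iso; rewrite /C; lia.
have /same_col_discP[f If fc] := vv'.
by rewrite -(disc_iso_center If) fc ?dist_refl.
Qed.

(** Induction on the distance [t] to the rich roots. On the way, [inner] vertices
    may occur; they are adjacent to a fixed vertex, so they move by at most two
    and [inner_rigid] applies. *)
Lemma outer_rigid t : t <= r2 -> exists C, forall v v', within Arich t v ->
  same_col_disc phi phi v v' C -> dist v v' <= 2 + 2 * (r2 - t) -> v = v'.
Proof.
have [rad1 _] := radius_ge 0; have [Ci hi] := inner_rigid (leqnn r1).
elim: t => [_|t IHt tr].
  have [C h] := roots_rigid 0; exists C => v v' /within0[Av bv] vv' dvv'.
  apply: contrapT => neq; have [_ /(_ bv)] := h v v' Av vv' neq.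
  by move: dvv'; rewrite /r2; lia.
have [C1 IH] := IHt (ltnW tr).
have [|C2 dr] := @down_rigid Arich t 2 C1 local_Arich.
  by move=> y y' yt yy' dyy'; apply: IH => //; lia.
have [C3 li] := local_inner.
pose C := (C1 + C2 + C3 + Ci).+1; exists C => v v' vt vv' dvv'.
have iso k : k <= C -> same_col_disc phi phi v v' k.
  by move=> kC; exact: same_col_disc_le vv'.
have [vt'|nvt] := pselect (within Arich t v).
  by apply: IH => //; [apply: iso; rewrite /C; lia | lia].
have /same_col_discP[f If fc] := vv'; have fv := disc_iso_center If.
have d2 : dist v v' <= 2.
  have [y vy yt] := within_down vt nvt; have vy1 := dist_adj vy.
  have ad : adj v' (f y) by rewrite -fv (disc_iso_adj If) ?dist_refl // /C; lia.
  have ey : y = f y.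
    apply: IH => //; first by apply: (same_col_disc_shift If fc); rewrite /C; lia.
    have := dist_triangle v y (f y); have := dist_triangle v' v (f y).
    by have := dist_adj ad; rewrite (dist_sym y v); lia.
  have := dist_triangle y v v'; rewrite {2}ey (dist_sym (f y)).
  by have := dist_adj ad; lia.
have [iv|niv] := pselect (inner v).
  by apply: hi => //; [apply: iso; rewrite /C; lia | rewrite subnn].
have niv' : ~ inner v'.
  move=> iv'; apply: niv; apply: li iv'; apply: same_col_disc_sym; apply: iso.
  by rewrite /C; lia.
have nA u : ~ inner u -> ~ A 0 u by move=> niu Au; apply: niu; exact: within_self.
apply: siblings_rigid => //; [exact: nA | exact: nA | | by rewrite -fv fc ?dist_refl].
by move=> _; apply: dr => //; apply: iso; rewrite /C; lia.
Qed.

Lemma step_rigid : exists C, forall v v', same_col_disc phi phi v v' C ->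
  dist v v' <= 2 -> v = v'.
Proof.
have [C1 h1] := inner_rigid (leqnn r1); have [C2 h2] := outer_rigid (leqnn r2).
exists (C1 + C2) => v v' vv' d2.
case: (ls_cover (l_spec 0) v) => [iv|[a [Aa ba va]]].
  by apply: h1 => //; [apply: same_col_disc_le vv'; lia | lia].
apply: h2; [by exists a | by apply: same_col_disc_le vv'; lia | by lia].
Qed.

(** If a colored isomorphism between large discs has a small displacement at one
    vertex, compared with the radius of some layer, then it fixes a root of that
    layer, and fixing propagates along paths since neighbors of fixed vertices
    move by at most two. *)
Theorem coloring_rigid L : 0 < L -> exists R, forall x x', dist x x' = L ->
  ~ same_col_disc phi phi x x' R.
Proof.
move=> L0; have [C1 h1] := roots_rigid L; have [C2 h2] := step_rigid.
have [_ [/local_predP[C3 lA] _]] := local_marks_from L.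
pose r := radius (l L); have [rad1 rad2] := radius_ge L.
(* The paths from [x] to a root nearby and back stay in the disc of radius [92 * r];
   the other terms let the local arguments apply at all their vertices. *)
pose R := 92 * r + C1 + C2 + C3 + 1.
exists R => x x' dxx' /same_col_discP[f If fc]; have fx := disc_iso_center If.
have [a [xa fa]] : exists a, dist x a <= 46 * r /\ f a = a.
  have fix_root a k : A L a -> dist x a <= k -> k <= 46 * r ->
      dist a (f a) <= 2 * k + r /\ (f a <> a ->
        33 * r < dist a (f a) /\ (rich (l L) a -> 138 * r < dist a (f a))).
    move=> Aa xa kr; split.
      have := dist_triangle x a (f a); have := dist_triangle x' x (f a).
      rewrite -{2}fx (disc_iso_dist If) ?dist_refl; last by rewrite /R; lia.
      by rewrite (dist_sym a x) dxx'; rewrite -/r in rad2; lia.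
    move=> neq; apply: h1 => //; last by move=> /esym.
    by apply: (same_col_disc_shift If fc); rewrite /R; lia.
  case: (ls_cover (l_spec L) x) => [[a Aa xa]|[a [Aa ba xa]]].
    exists a; split; first by move: xa; rewrite -/r; lia.
    have [|d1 d2] := fix_root a (11 * r) Aa xa; first by lia.
    by apply: contrapT => /d2[]; rewrite -/r in rad1; lia.
  exists a; split=> //; have [|d1 d2] := fix_root a (46 * r) Aa xa; first by lia.
  by apply: contrapT => /d2[_ /(_ ba)]; rewrite -/r in rad1; lia.
have fixed k v : dist a v = k -> k <= 46 * r -> f v = v.
  elim: k v => [|k IHk] v av kr; first by rewrite -(dist_eq0 av).
  have [z zv az] := dist_predr av; have fz := IHk z az (ltnW kr).
  have xz := dist_triangle a x z; have xv := dist_triangle a x v.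
  have ad : adj z (f v) by rewrite -{1}fz (disc_iso_adj If) //; rewrite /R; lia.
  apply/esym; apply: h2.
    by apply: (same_col_disc_shift If fc); rewrite /R; lia.
  have := dist_triangle z v (f v); have := dist_adj zv; have := dist_adj ad.
  by rewrite (dist_sym v z); lia.
have := fixed (dist a x) x erefl; rewrite dist_sym fx => /(_ xa) ex.
by move: dxx'; rewrite ex dist_refl => L00; rewrite -L00 in L0.
Qed.

End Assembly.

(** * Limit aperiodicity *)

Definition strongly_aperiodic (X : graph) (n : nat) (phi : X -> 'I_n) :=
  forall L, 0 < L -> exists R, forall x x', dist x x' = L ->
    ~ same_col_disc phi phi x x' R.

(** A large disc of the limit around the base point, containing a vertex and its
    image under the automorphism with their discs, has a copy in [X]. *)
Lemma strongly_aperiodic_limit (X : graph) (n : nat) (phi : X -> 'I_n) :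
  strongly_aperiodic phi -> limit_aperiodic phi.
Proof.
move=> SA Q clQ f If y; apply: contrapT => neq.
pose psi := @pc_color Q; pose p := pc_point Q; pose L := dist y (f y).
have L0 : 0 < L by rewrite lt0n; apply/eqP => /dist_eq0/esym.
have [R noR] := SA L L0; pose r := (dist p y + L + R).+1.
have [P [x [g Ig gx]] PQ] := clQ r isT.
have : same_col_disc phi psi x p r.
  apply: same_col_disc_trans (same_col_disc_sym _) PQ.
  by rewrite -[x]gx; exact: (color_iso_disc _ _ Ig).
move=> /same_col_discP[h Ih hc].
have [u xu hu] : exists2 u, dist x u <= dist p y & h u = y.
  have [||u xu hu] := disc_iso_lift Ih (u := x) (v := y) (s := dist p y).
  - by rewrite dist_refl /r; lia.
  - by rewrite (disc_iso_center Ih).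
  - by exists u => //; rewrite (disc_iso_center Ih) in xu.
have [||u' uu' hu'] := disc_iso_lift Ih (u := u) (v := f y) (s := L).
- by rewrite /r; lia.
- by rewrite hu.
rewrite hu -/L in uu'.
have dL : dist u u' = L.
  by rewrite -(disc_iso_dist Ih) ?hu ?hu' // /r; lia.
apply: (noR u u' dL).
have xu' := dist_triangle u x u'.
have s1 : same_col_disc phi psi u y R.
  by rewrite -hu; apply: (same_col_disc_shift Ih hc); rewrite /r; lia.
have s2 : same_col_disc phi psi u' (f y) R.
  by rewrite -hu'; apply: (same_col_disc_shift Ih hc); rewrite /r; lia.
apply: same_col_disc_trans s1 _; apply: same_col_disc_trans (same_col_disc_sym s2).
exact: color_iso_disc.
Qed.

(** * Minimal colorings *)

(** Equivalently, the closure of the set of classes of [psi] is contained in that of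
    [phi]. *)
Definition dominated (X : graph) (n : nat) (psi phi : X -> 'I_n) :=
  forall x r, exists y, same_col_disc psi phi x y r.

Section Minimal.
Variables (X : graph) (n : nat).
Implicit Types phi psi chi : X -> 'I_n.

Lemma same_col_disc_refl phi psi x r : (forall u, dist x u <= r -> psi u = phi u) ->
  same_col_disc phi psi x x r.
Proof.
move=> e; apply/same_col_discP; exists id => [|u xu]; last by rewrite e.
by split=> //; split=> // y yr; exists y.
Qed.

Lemma dominated_refl phi : dominated phi phi.
Proof. by move=> x r; exists x; exact: same_col_disc_refl. Qed.

Lemma dominated_trans chi psi phi : dominated chi psi -> dominated psi phi ->
  dominated chi phi.
Proof.
move=> h1 h2 x r; have [y xy] := h1 x r; have [z yz] := h2 y r.
by exists z; exact: same_col_disc_trans xy yz.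
Qed.

Lemma limit_aperiodic_dominated psi phi : dominated psi phi ->
  limit_aperiodic phi -> limit_aperiodic psi.
Proof.
move=> h la Q clQ; apply: la => r r0.
have [P [x [g Ig gx]] PQ] := clQ r r0; have [y xy] := h x r.
have hy : exists2 f : PCGraph y phi -> PCGraph y phi, color_iso phi phi f & f y = y.
  by exists id => //; split=> //; exists id.
exists (PCGraph y phi); first by exists y.
apply: same_col_disc_trans (same_col_disc_sym xy) _.
apply: same_col_disc_trans (same_col_disc_sym _) PQ.
by rewrite -[x]gx; exact: (color_iso_disc _ _ Ig).
Qed.

(** Compactness of the space of colorings: the limit along an ultrafilter
    containing [G] takes at each vertex the color that is taken by the colorings
    of a set of the ultrafilter. *)
Lemma cluster_coloring (G : set_system (X -> 'I_n)) : ProperFilter G ->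
  exists psi, forall S, G S -> forall x r,
    exists2 chi, S chi & forall u, dist x u <= r -> chi u = psi u.
Proof.
move=> PG; have [U [UU GU]] := ultraFilterLemma PG.
have ex u : {c | U [set chi | chi u = c]}.
  apply: cid; apply: contrapT => /forallNP none.
  have : \forall chi \near U, forall c : 'I_n, chi u <> c.
    apply: filter_forall => c; have [] := in_ultra_setVsetC [set chi | chi u = c] UU => //.
    by move=> /none.
  by move=> /filter_ex[chi] /(_ (chi u)).
exists (fun u => sval (ex u)) => S GS x r.
have : U (S `&` \bigcap_(u in [set` fset_set (disc x r)]) [set chi | chi u = sval (ex u)]).
  apply: filterI; first exact: GU.
  by apply: filter_bigI => u _; exact: svalP (ex u).
move=> /filter_ex[chi [Schi h]]; exists chi => // u xu; apply: h => /=.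
by rewrite in_fset_set; [rewrite inE | exact: disc_finite].
Qed.

(** A chain has a lower bound, namely a cluster point of its tails. *)
Lemma minimal_coloring phi : exists2 psi, dominated psi phi &
  forall chi, dominated chi psi -> dominated psi chi.
Proof.
pose T := {psi : X -> 'I_n | dominated psi phi}.
pose R (a b : T) := `[< dominated (sval b) (sval a) >].
pose t0 : T := exist (fun psi => dominated psi phi) phi (dominated_refl phi).
have [|||[psi psi_phi] max] := @ZL_preorder T t0 R.
- by move=> t; apply/asboolP; exact: dominated_refl.
- by move=> a b c /asboolP ab /asboolP bc; apply/asboolP; exact: dominated_trans bc ab.
- move=> C totC; have [[a0 Ca0]|C0] := pselect (exists a, C a); last first.
    by exists t0 => s Cs; case: C0; exists s.
  pose tail (a : T) := [set sval b | b in [set b | C b /\ dominated (sval b) (sval a)]].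
  pose G := filter_from C tail.
  have PG : ProperFilter G.
    apply: filter_from_proper => [|a Ca]; last first.
      by exists (sval a), a => //; split=> //; exact: dominated_refl.
    apply: filter_from_filter; first by exists a0.
    move=> a b Ca Cb; have [/asboolP ab|/asboolP ba] := totC a b Ca Cb.
      exists b => // _ [c [Cc cb] <-]; split; exists c => //; split=> //.
      exact: dominated_trans cb ab.
    exists a => // _ [c [Cc ca] <-]; split; exists c => //; split=> //.
    exact: dominated_trans ca ba.
  have [psi hpsi] := cluster_coloring PG.
  have low a : C a -> dominated psi (sval a).
    move=> Ca x r; have [|chi [b [Cb ba] <-] e] := hpsi (tail a) _ x r.
      by exists a.
    have [y xy] := ba x r; exists y; apply: same_col_disc_trans xy.
    exact: same_col_disc_refl.
  have psi_phi : dominated psi phi by apply: dominated_trans (low a0 Ca0) (svalP a0).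
  by exists (exist (fun psi => dominated psi phi) psi psi_phi) => s Cs; apply/asboolP; exact: low.
exists psi => // chi chi_psi.
have chi_phi := dominated_trans chi_psi psi_phi.
have := max (exist (fun psi => dominated psi phi) chi chi_phi); rewrite /R /= => h.
by apply/asboolP; apply: h; apply/asboolP.
Qed.

(** In a repetitive graph, minimality forces repetitivity: were a colored disc
    missing from larger and larger discs of [psi], copying those onto concentric
    discs would produce in the limit a coloring below [psi] without it. *)
Lemma minimal_repetitive psi : repetitive X ->
  (forall chi, dominated chi psi -> dominated psi chi) -> repetitive_coloring psi.
Proof.
move=> [p [r [r_gt0 r_mono r_oo r_dense]]] min; exists p, r; split=> // i.
apply: contrapT => sparse.
have r_large k : exists M, forall m, M <= m -> k <= r m.
  have /cvgnyPge/(_ k) [M _ hM] := r_oo.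
  by exists M => m; exact: hM.
have gap m : {f : X -> X | exists y, disc_iso p y (r m) f /\
    forall u, dist p u <= r m -> ~ same_col_disc psi psi (f u) p (r i)}.
  apply: cid; have [C C0 hC] := r_dense m.
  have [x hx] : exists x, forall a, same_col_disc psi psi a p (r i) -> C + r m < dist x a.
    apply: contrapT => none; apply: sparse; exists (C + r m); first by rewrite addn_gt0 C0.
    move=> x; apply: contrapT => nx; apply: none; exists x => a sa.
    by rewrite ltnNge; apply/negP => xa; apply: nx; exists a.
  have [y [f If] xy] := hC x; have [g Ig _] := disc_iso_inv If.
  exists g, y; split=> // u pu su; have := hx _ su; rewrite ltnNge => /negP; apply.
  apply: leq_trans (dist_triangle y x (g u)) _; apply: leq_add => //.
  exact: (disc_iso_sub Ig).
pose f m := sval (gap m); pose chi m := psi \o f m.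
have fP m : exists y, disc_iso p y (r m) (f m) /\
    forall u, dist p u <= r m -> ~ same_col_disc psi psi (f m u) p (r i).
  exact: svalP (gap m).
pose tail M := [set chi m | m in [set m | M <= m]].
have PG : ProperFilter (filter_from setT tail).
  apply: filter_from_proper => [|M _]; last by exists (chi M), M => /=.
  apply: filter_from_filter; first by exists 0.
  move=> M N _ _; exists (maxn M N) => // _ [m /= mm <-].
  by split; exists m => //=; apply: leq_trans mm; rewrite ?leq_maxl ?leq_maxr.
have [psi' hpsi'] := cluster_coloring PG.
have copy x s : exists m, dist p x + s <= r m /\ same_col_disc psi' psi x (f m x) s.
  have [M hM] := r_large (dist p x + s).
  have [|_ [m /= Mm <-] e] := hpsi' (tail M) _ x s; first by exists M.
  exists m; split; first exact: hM.
  have [y [If _]] := fP m; apply/same_col_discP; exists (f m).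
    by apply: (disc_iso_shift If); exact: hM.
  by move=> u xu; rewrite -e.
have [|x px] := min psi' _ p (r i).
  by move=> x s; have [m [_ h]] := copy x s; exists (f m x).
have [m [pxm xm]] := copy x (r i); have [y [_ miss]] := fP m.
apply: (miss x); first by lia.
exact: same_col_disc_sym (same_col_disc_trans px xm).
Qed.

End Minimal.

(** * Distinguishing numbers and the degree *)

Lemma coloring_exists (X : graph) (n : nat) : infinite_set [set: X] ->
  countable [set: X] -> (forall x : X, degree x <= n) ->
  0 < n /\ exists phi : X -> 'I_n, limit_aperiodic phi.
Proof.
move=> Xinf Xcount degn.
have [x0 _] : [set: X] !=set0 by exact: infinite_setN0.
have n0 : 0 < n.
  have [y xy] := sphere_neq0 Xinf x0 1; apply: leq_trans (degn x0).
  by apply: (setcard_gt0 (adj_fin x0)); exact: adj_dist xy.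
split=> //; case: n n0 degn => // D _ degD.
have [F [l [F_next l_spec]]] := layer_tower Xinf Xcount degD.
pose phi v : 'I_D.+1 := inord (color_index x0 l v).
have phiE v : phi v = color_index x0 l v :> nat.
  by rewrite inordK //; exact: (color_index_lt x0 degD l_spec).
exists phi; apply: strongly_aperiodic_limit => L L0.
exact: (coloring_rigid F_next l_spec phiE L0).
Qed.

Import Order.TTheory GRing.Theory Num.Theory.
Local Open Scope ereal_scope.

(** The supremum of the degrees is either infinite or attained. *)
Lemma deg_bound (R : realType) (X : graph) : infinite_set [set: X] ->
  deg R X = +oo \/ exists n, (forall x : X, degree x <= n)%N /\ (n%:R)%:E <= deg R X.
Proof.
move=> Xinf; have [[B hB]|unb] := pselect (exists B, forall x : X, (degree x <= B)%N).
  right; have [x0 _] : [set: X] !=set0 by exact: infinite_setN0.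
  pose P k := `[< exists x : X, degree x = k >].
  have exP : exists k, P k by exists (degree x0); apply/asboolP; exists x0.
  have ubP k : P k -> (k <= B)%N by move=> /asboolP[x <-].
  case: (ex_maxnP exP ubP) => n /asboolP[x xn] nmax; exists n; split.
    by move=> y; apply: nmax; apply/asboolP; exists y.
  by apply: ereal_sup_ubound; exists x => //; rewrite xn.
left; apply: eq_infty => t.
have [x tx] : exists x : X, (Num.truncn `|t|%R < degree x)%N.
  apply: contrapT => none; apply: unb; exists (Num.truncn `|t|%R) => x.
  by rewrite leqNgt; apply/negP => tx; apply: none; exists x.
apply: (@le_trans _ _ ((degree x)%:R)%:E); last by apply: ereal_sup_ubound; exists x.
rewrite lee_fin; apply: le_trans (ler_norm t) _; apply/ltW.
by apply: lt_le_trans (truncnS_gt _) _; rewrite ler_nat.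
Qed.

Theorem theorem1p4 (R : realType) (X : graph)
    (Xcountable : countable [set: X]) (Xinfinite : infinite_set [set: X]) :
  D_L R X <= deg R X /\ (repetitive X -> D_RL R X <= deg R X).
Proof.
have [->|[n [degn nX]]] := deg_bound R Xinfinite; first by split=> [|_]; exact: leey.
have [n0 [phi la]] := coloring_exists Xinfinite Xcountable degn.
split=> [|rep]; apply: le_trans nX; apply: ereal_inf_lbound; exists n => //.
  by split=> //; exists phi.
split=> //; have [psi psi_phi psi_min] := minimal_coloring phi.
exists psi; split; first exact: minimal_repetitive.
exact: limit_aperiodic_dominated psi_phi la.
Qed.
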